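(* Let $K$ be an imaginary quadratic number field (embedded in $\mathbb C$) whose ring of integers $\mathcal O_K$ is principal. There exist constants $C>0$ and $x_0\geq 1$ depending only on $K$ such that for every nonzero ideal $\mathfrak m$ of $\mathcal O_K$, every $z\in\mathbb C^\times$, every $\theta\in\,]0,2\pi]$ and every $x\geq x_0$, $$\Big|\sum_{a\in\mathfrak m\cap C(z,\theta,x)}\varphi_K(a)-\frac{\theta}{2\,\sqrt{|D_K|}\,\zeta_K(2)\,c_{\mathfrak m}}\;x^4\Big|\leq C\,x^3 .$$ That is, as $x\to+\infty$, the sum equals $\frac{\theta}{2\sqrt{|D_K|}\zeta_K(2)c_{\mathfrak m}}x^4+\operatorname{O}(x^3)$, where the function $\operatorname{O}(\cdot)$ depends only on $K$ and is uniform in $\mathfrak m$, $z$ and $\theta$.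
   Context: $D_K$ is the discriminant of $K$ and $\zeta_K$ its Dedekind zeta function. For a nonzero ideal $\mathfrak a$ of $\mathcal O_K$, $\mathtt N(\mathfrak a)=\operatorname{Card}(\mathcal O_K/\mathfrak a)$ and $\varphi_K(\mathfrak a)=\operatorname{Card}\big((\mathcal O_K/\mathfrak a)^\times\big)=\mathtt N(\mathfrak a)\prod_{\mathfrak p\mid\mathfrak a}\big(1-\frac1{\mathtt N(\mathfrak p)}\big)$, where $\mathfrak p$ ranges over (nonzero) prime ideals; for $a\in\mathcal O_K-\{0\}$, $\varphi_K(a)=\varphi_K(a\mathcal O_K)$. For every nonzero ideal $\mathfrak m$ of $\mathcal O_K$, $$c_{\mathfrak m}=\mathtt N(\mathfrak m)\prod_{\mathfrak p\mid\mathfrak m}\Big(1+\frac1{\mathtt N(\mathfrak p)}\Big).$$ For $z\in\mathbb C^\times$, $\theta\in\,]0,2\pi]$ and $R\geq0$, the truncated angular sector is $$C(z,\theta,R)=\Big\{\rho\,e^{it}z:\ t\in\,\big]-\tfrac\theta2,\tfrac\theta2\big],\ 0<\rho\leq\tfrac{R}{|z|}\Big\}\subset\mathbb C .$$ *)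

(* Defs.v *)
From HB Require Import structures.
From mathcomp Require Import all_boot all_order all_algebra all_field.
From mathcomp Require Import finmap.
From mathcomp Require Import complex.
From mathcomp Require Import all_classical all_reals all_analysis.

Set Implicit Arguments.
Unset Strict Implicit.
Unset Printing Implicit Defensive.

Import Order.TTheory GRing.Theory Num.Theory.

Local Open Scope classical_set_scope.
Local Open Scope ring_scope.

(* [fset_set A] is empty when [A] is infinite, so infinite sets get 0. *)
Definition ncard (T : choiceType) (A : set T) : nat := #|` fset_set A|%fset.

Section NumberField.
Variable K : fieldExtType rat.
Implicit Types (x y a : K) (I J m P : set K).

Definition ring_of_integers : set K :=
  [set x | integralOver (intr : int -> K) x].

Local Notation OK := ring_of_integers.

Definition is_ideal I : Prop :=
  [/\ I `<=` OK, I 0, (forall x y, I x -> I y -> I (x + y))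
    & (forall a x, OK a -> I x -> I (a * x))].

Definition nonzero_ideal I : Prop := is_ideal I /\ I <> [set 0].

Definition principal_ideal a : set K := [set a * b | b in OK].

Definition principal_ring_of_integers : Prop :=
  forall I, is_ideal I -> exists2 a, OK a & I = principal_ideal a.

Definition ideal_mul I J : set K :=
  smallest is_ideal [set x * y | x in I & y in J].

Definition ideal_divides I J : Prop :=
  exists2 I', is_ideal I' & J = ideal_mul I I'.

Definition nonzero_prime_ideal P : Prop :=
  [/\ nonzero_ideal P, P <> OK
    & forall x y, OK x -> OK y -> P (x * y) -> P x \/ P y].

Definition icoset I x : set K := [set x + y | y in I].

Definition iquotient I : set (set K) := [set icoset I x | x in OK].

Definition iquotient_units I : set (set K) :=
  [set icoset I x | x in [set x | OK x /\ exists2 y, OK y & I (x * y - 1)]].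

Definition ideal_norm I : nat := ncard (iquotient I).

Definition ideal_phi I : nat := ncard (iquotient_units I).

Definition elt_phi a : nat := ideal_phi (principal_ideal a).

Definition field_trace x : rat :=
  \tr (passmx.mxof (vbasis {:K}) (vbasis {:K}) (amulr x)).

Definition integral_basis (w : (\dim {:K}).-tuple K) : Prop :=
  basis_of {:K} w /\
  OK = [set \sum_(i < \dim {:K}) (tnth w i *~ c i)
       | c in [set: {ffun 'I_(\dim {:K}) -> int}]].

Definition basis_disc (w : (\dim {:K}).-tuple K) : rat :=
  \det (\matrix_(i, j) field_trace (tnth w i * tnth w j)).

(* All integral bases have the same discriminant, so the choice made by [xget]
   does not matter; the default 0 is never used, integral bases exist. *)
Definition field_disc : rat :=
  xget 0 [set d | exists2 w, integral_basis w & d = basis_disc w].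

Section Real.
Variable R : realType.

(* The Dirichlet series, hence meaningful for real s > 1 only. *)
Definition dedekind_zeta (s : R) : R :=
  fine (\esum_(I in [set I | nonzero_ideal I])
          ((ideal_norm I)%:R `^ (- s))%:E).

Definition c_ideal m : R :=
  (ideal_norm m)%:R *
  \big[*%R/1]_(P \in [set P | nonzero_prime_ideal P /\ ideal_divides P m])
     (1 + ((ideal_norm P)%:R)^-1 : R).

Definition imaginary_quadratic (iota : {rmorphism K -> complex R}) : Prop :=
  \dim {:K} = 2%N /\ ~ (forall x, complex.Im (iota x) = 0).

End Real.
End NumberField.

Definition angular_sector (R : realType) (z : complex R) (theta r : R) :
    set (complex R) :=
  [set w | exists rho t : R,
     [/\ - (theta / 2) < t <= theta / 2,
         0 < rho <= r / ComplexField.Normc.normc z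
       & w = Complex (rho * cos t) (rho * sin t) * z]].

(* Main.v *)
Require Import Defs.
From mathcomp Require Import all_boot all_order all_algebra all_field.
From mathcomp Require Import finmap complex ring lra zify.
From mathcomp Require Import all_classical all_reals all_analysis.

(** Write O for the ring of integers and [qnorm a] for |a|^2.  Since O is
    principal, every nonzero ideal is aO for some a, the index of aO in O is
    |a|^2, and
      phi_K(a) = |a|^2 * prod_(P containing a) (1 - 1/N(P)).
    So the sum to estimate is the sum of |a|^2 over the points of the lattice
    bO = m in a sector, twisted by Euler factors.

    Without the twist this is a lattice point problem.  As O = Z + Z omega has
    covolume h = Im omega = sqrt|D_K| / 2 ([sqrt_disc]), the points of O in a
    sector of radius r and angle theta number theta r^2 / (2h) + O(r): sum the
    lengths of the horizontal rows of the sector.  Abel summation gives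
    theta r^4 / (4h) + O(r^3) for the sum of |a|^2 ([sector_sum]).  The constant
    is the same for all directions and for all r > 0: a small sector contains no
    point of O, and then the main term is itself O(r^3).  Dividing by b turns
    bO into O, rotates the sector and divides its radius by |b|, so that the sum
    over bO is theta x^4 / (4h |b|^2) + O(x^3 / |b|).

    The Euler factors are then inserted one prime at a time ([sieve]).  Let P = pO
    be a new prime.  If P contains b, every term is multiplied by 1 - 1/N(P).
    Otherwise the points of bO that lie in P are those of bpO, so that 1/N(P)
    times the sum over bpO has to be subtracted; the main term is multiplied
    by 1 - 1/N(P)^2, and the error relative to x^3 / |b| is multiplied by at most
    1 + 1/(N(P)|p|) = 1 + N(P)^(-3/2).  The sum of N(I)^(-3/2) over all nonzero
    ideals converges ([ideal_sum_bound]), so the error is O(x^3) with a constant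
    that depends neither on the set S of primes used, nor on m, z and theta.

    It remains to let S contain every prime of norm at most Y.  If Y is large
    in terms of x and b, the twist by S is the true phi_K on the sector.  The
    main term is theta x^4 / (4 h c_m) times the product over S of 1 - N(P)^(-2),
    because (1 - 1/N)(1 + 1/N) = 1 - 1/N^2 at the primes containing b.
    Removing from zeta_K(2) the multiples of one prime after the other shows
    that this product is the sum of N(I)^(-2) over the ideals prime to S, divided
    by zeta_K(2) ([zeta2_coprime_to_prod]).  That sum tends to 1 as Y grows
    ([zeta2_coprime_to_le]), and Y may depend on everything, since no constant
    depends on S. *)

Set Implicit Arguments.
Unset Strict Implicit.
Unset Printing Implicit Defensive.

Import Order.TTheory GRing.Theory Num.Theory.
(* For the linearity of the map from endomorphisms to matrices. *)
Import passmx.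

Local Open Scope classical_set_scope.
Local Open Scope ring_scope.

(** * Imaginary quadratic fields and their conjugation *)

(** The size is a variable because the matrices of interest are indexed by the
    dimension of K, which equals 2 only by hypothesis. *)
Lemma quadratic_Cayley_Hamilton (F : fieldType) (n : nat) (A : 'M[F]_n) :
  n = 2 -> A *m A = \tr A *: A - (\det A)%:M.
Proof.
move=> n2; subst n.
have sz : size (char_poly A) = 3 by rewrite size_char_poly.
have c2 : (char_poly A)`_2 = 1.
  by have := char_poly_monic A; rewrite monicE /lead_coef sz => /eqP.
have c1 : (char_poly A)`_1 = - \tr A.
  exact: (@char_poly_trace F 2 A (ltn0Sn 1)).
have c0 : (char_poly A)`_0 = \det A by rewrite char_poly_det sqrrN expr1n mul1r.
have pE : char_poly A = (\det A)%:P - (\tr A)%:P * 'X + 'X ^+ 2.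
  move: (char_poly A) sz c0 c1 c2 => p sz c0 c1 c2.
  apply/polyP => -[|[|[|i]]]; rewrite !coefE /=.
  - by rewrite c0 mulr0 subr0 addr0.
  - by rewrite c1 mulr1 sub0r addr0.
  - by rewrite c2 mulr0 subr0 add0r.
  - by rewrite nth_default ?sz// mulr0 subr0 addr0.
have := Cayley_Hamilton A.
rewrite pE rmorphD rmorphB rmorphM /= rmorphXn /= !horner_mx_C horner_mx_X expr2.
move=> /eqP; rewrite addrC addr_eq0 => /eqP.
by rewrite -[A * A]/(A *m A) -[_ * A]/(_ *m A) mul_scalar_mx => ->; rewrite opprB.
Qed.

Section QuadraticField.
Variables (R : realType) (K : fieldExtType rat).
Variable iota : {rmorphism K -> complex R}.
Local Notation re a := (complex.Re (iota a)).
Local Notation im a := (complex.Im (iota a)).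
Local Notation O := (@ring_of_integers K).

Definition qnorm (a : K) : R := re a ^+ 2 + im a ^+ 2.

Lemma iota_rat (q : rat) : iota q%:A = (ratr q : R)%:C%C.
Proof.
rewrite -[LHS]/((iota \o in_alg K) q) fmorph_eq_rat.
by rewrite (fmorph_rat (real_complex R)).
Qed.
Lemma iota_int (q : int) : iota q%:~R = (q%:~R : R)%:C%C.
Proof. by rewrite !rmorph_int. Qed.
Lemma reD a b : re (a + b) = re a + re b.
Proof. by rewrite rmorphD; case: (iota a) (iota b) => [? ?] [? ?]. Qed.
Lemma imD a b : im (a + b) = im a + im b.
Proof. by rewrite rmorphD; case: (iota a) (iota b) => [? ?] [? ?]. Qed.
Lemma reN a : re (- a) = - re a.
Proof. by rewrite rmorphN; case: (iota a). Qed.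
Lemma imN a : im (- a) = - im a.
Proof. by rewrite rmorphN; case: (iota a). Qed.
Lemma reM a b : re (a * b) = re a * re b - im a * im b.
Proof. by rewrite rmorphM; case: (iota a) (iota b) => [? ?] [? ?]. Qed.
Lemma imM a b : im (a * b) = re a * im b + im a * re b.
Proof. by rewrite rmorphM; case: (iota a) (iota b) => [? ?] [? ?]. Qed.
Lemma re_rat (q : rat) : re q%:A = ratr q. Proof. by rewrite iota_rat. Qed.
Lemma im_rat (q : rat) : im q%:A = 0. Proof. by rewrite iota_rat. Qed.
Lemma re_int (q : int) : re q%:~R = q%:~R. Proof. by rewrite iota_int. Qed.
Lemma im_int (q : int) : im q%:~R = 0. Proof. by rewrite iota_int. Qed.
Lemma re1 : re 1 = 1. Proof. exact: (re_int 1). Qed.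
Lemma im1 : im 1 = 0. Proof. exact: (im_int 1). Qed.
Lemma re0 : re 0 = 0. Proof. exact: (re_int 0). Qed.
Lemma im0 : im 0 = 0. Proof. exact: (im_int 0). Qed.
Lemma iota_inj a b : re a = re b -> im a = im b -> a = b.
Proof.
move=> h1 h2; apply: (fmorph_inj iota).
by case: (iota a) (iota b) h1 h2 => [? ?] [? ?] /= -> ->.
Qed.

Lemma qnormM a b : qnorm (a * b) = qnorm a * qnorm b.
Proof. by rewrite /qnorm reM imM; ring. Qed.
Lemma qnorm_ge0 a : 0 <= qnorm a.
Proof. by rewrite addr_ge0 ?sqr_ge0. Qed.
Lemma qnorm_eq0 a : (qnorm a == 0) = (a == 0).
Proof.
apply/idP/eqP => [|->]; last by rewrite /qnorm re0 im0 expr0n addr0.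
rewrite /qnorm paddr_eq0 ?sqr_ge0// !sqrf_eq0 => /andP[/eqP h1 /eqP h2].
by apply: iota_inj; rewrite ?re0 ?im0.
Qed.
Lemma qnorm_gt0 a : a != 0 -> 0 < qnorm a.
Proof. by rewrite lt_def qnorm_ge0 qnorm_eq0 andbT. Qed.
Lemma qnorm1 : qnorm 1 = 1.
Proof. by rewrite /qnorm re1 im1 expr0n expr1n addr0. Qed.
Lemma qnormN a : qnorm (- a) = qnorm a.
Proof. by rewrite /qnorm reN imN !sqrrN. Qed.

Lemma OKD a b : O a -> O b -> O (a + b).
Proof. exact: integral_add. Qed.
Lemma OKB a b : O a -> O b -> O (a - b).
Proof. exact: integral_sub. Qed.
Lemma OKM a b : O a -> O b -> O (a * b).
Proof. exact: integral_mul. Qed.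
Lemma OKN a : O a -> O (- a).
Proof. exact: integral_opp. Qed.
Lemma OK_int (n : int) : O n%:~R.
Proof. exact: integral_id. Qed.
Lemma OK_mulz a (n : int) : O a -> O (a *~ n).
Proof. by move=> Oa; rewrite -mulrzl; apply: OKM => //; exact: OK_int. Qed.
Lemma OK0 : O 0. Proof. exact: (OK_int 0). Qed.
Lemma OK1 : O 1. Proof. exact: (OK_int 1). Qed.

(** The polynomial that makes [phi q] integral vanishes at q, hence at the image
    of q among the algebraic numbers, where a rational algebraic integer is
    known to be an integer. *)
Lemma rat_integral_int (F : fieldType) (phi : {rmorphism rat -> F}) (q : rat) :
  integralOver (intr : int -> F) (phi q) -> exists n : int, q = n%:~R.
Proof.
move=> [p pm pr].
have pr' : root (map_poly (intr : int -> rat) p) q.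
  rewrite -(fmorph_root phi) -map_poly_comp /=.
  by under eq_map_poly => x do rewrite /= rmorph_int.
have : (ratr q : algC) \in Num.int.
  apply: Cint_rat_Aint; first exact: Crat_rat.
  apply: (@root_monic_Aint (map_poly intr p)).
  - have := pr'; rewrite -(fmorph_root (ratr : rat -> algC)) -map_poly_comp /=.
    by under eq_map_poly => x do rewrite /= ratr_int.
  - exact: monic_map.
  - by apply/polyOverP => i; rewrite coef_map /= intr_int.
move=> /intrP [n nE]; exists n; apply: (fmorph_inj (ratr : rat -> algC)).
by transitivity (n%:~R : algC); [exact: nE | symmetry; exact: ratr_int].
Qed.

Hypothesis hIQ : imaginary_quadratic iota.

Lemma dimK : \dim {:K} = 2%N. Proof. by case: hIQ. Qed.

Lemma field_traceD (a b : K) : field_trace (a + b) = field_trace a + field_trace b.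
Proof. by rewrite /field_trace !linearD. Qed.

(** The theorem of Cayley and Hamilton for the matrix of the multiplication by
    [a], applied to the coordinates of 1. *)
Lemma quadratic_eq (a : K) : exists d : rat,
  a * a = field_trace a *: a - d%:A.
Proof.
exists (\det (passmx.mxof (vbasis {:K}) (vbasis {:K}) (amulr a))).
have bas := vbasisP {:K}.
apply: (can_inj (passmx.rVofK bas)).
have app u v : passmx.rVof (vbasis {:K}) (u * v) =
   passmx.rVof (vbasis {:K}) u *m passmx.mxof (vbasis {:K}) (vbasis {:K}) (amulr v).
  by rewrite -(passmx.rVof_app _ bas) lfunE.
have a1 := app 1 a; rewrite mul1r in a1.
rewrite linearB !linearZ /= app {1}a1 -mulmxA quadratic_Cayley_Hamilton ?dimK//.
by rewrite mulmxBr -scalemxAr -a1 mul_mx_scalar scalerN.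
Qed.

Lemma field_traceZ (q : rat) (a : K) : field_trace (q *: a) = q * field_trace a.
Proof. by rewrite /field_trace !linearZ. Qed.

Lemma field_trace1 : field_trace (1 : K) = 2.
Proof.
rewrite /field_trace rmorph1 -[X in passmx.mxof _ _ X]/(\1%VF).
by rewrite passmx.mxof1 ?(basis_free (vbasisP _))// mxtrace1 dimK.
Qed.

Lemma basis_1x (x : K) : im x != 0 -> basis_of {:K} [:: 1; x].
Proof.
move=> x0; have fr : free [:: 1; x].
  rewrite free_cons seq1_free span_seq1; apply/andP; split; last first.
    by apply: contraNneq x0 => ->; rewrite im0.
  apply/vlineP => -[q qE]; have /eqP : im 1 = im (q *: x) by rewrite -qE.
  rewrite im1 -[q *: x]mul1r -scalerAr scalerAl imM re_rat im_rat mul0r addr0.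
  rewrite eq_sym mulf_eq0 (negPf x0) orbF fmorph_eq0 => /eqP q0.
  by move: qE; rewrite q0 scale0r => /eqP; rewrite oner_eq0.
by rewrite basisEfree fr subvf dimK.
Qed.

Lemma span_1x (x a : K) : im x != 0 -> exists p q : rat, a = p%:A + q *: x.
Proof.
move=> /basis_1x bas.
have : a \in span [:: 1; x] by rewrite (span_basis bas) memvf.
rewrite span_cons span_seq1 => /memv_addP[_ /vlineP[p ->]] [_ /vlineP[q ->]] ->.
by exists p, q.
Qed.

Lemma exists_nonreal : exists x : K, im x != 0.
Proof.
by case: hIQ => _ /existsNP[x /eqP]; exists x.
Qed.

Lemma reZ (q : rat) a : re (q *: a) = ratr q * re a.
Proof.
by rewrite -[a in LHS]mul1r scalerAl reM re_rat im_rat mul0r subr0.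
Qed.

Lemma imZ (q : rat) a : im (q *: a) = ratr q * im a.
Proof.
by rewrite -[a in LHS]mul1r scalerAl imM re_rat im_rat mul0r addr0.
Qed.

(** For a nonreal x the imaginary parts of both sides of
    x^2 = tr(x) x - d give tr(x) = 2 Re x; the trace of 1 is 2, and [1; x] is
    a basis. *)
Lemma field_traceE a : ratr (field_trace a) = 2 * re a.
Proof.
have [x x0] := exists_nonreal; have [p [q ->]] := span_1x a x0.
rewrite field_traceD !field_traceZ field_trace1 rmorphD !rmorphM /= ratr_nat.
have -> : re (p%:A + q *: x) = ratr p + ratr q * re x by rewrite reD re_rat reZ.
suff -> : ratr (field_trace x) = 2 * re x by ring.
have [d dE] := quadratic_eq x.
have : im (x * x) = im (field_trace x *: x - d%:A) by rewrite dE.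
rewrite imM imD imN im_rat subr0 imZ => h; apply: (mulIf x0); rewrite -h; ring.
Qed.

Lemma real_is_rat a : im a = 0 -> exists q : rat, a = q%:A.
Proof.
have [x x0] := exists_nonreal; have [p [q ->]] := span_1x a x0.
rewrite imD im_rat imZ add0r => /eqP; rewrite mulf_eq0 (negPf x0) orbF.
by rewrite fmorph_eq0 => /eqP ->; exists p; rewrite scale0r addr0.
Qed.

(** Complex conjugation on K: the trace of a is twice its real part. *)
Definition qconj (a : K) : K := (field_trace a)%:A - a.
Lemma re_qconj a : re (qconj a) = re a.
Proof. by rewrite reD reN re_rat field_traceE; ring. Qed.
Lemma im_qconj a : im (qconj a) = - im a.
Proof. by rewrite imD imN im_rat add0r. Qed.
Lemma qconjK : involutive qconj.
Proof. by move=> a; apply: iota_inj; rewrite ?re_qconj ?im_qconj ?opprK. Qed.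
Lemma qnorm_qconj a : qnorm (qconj a) = qnorm a.
Proof. by rewrite /qnorm re_qconj im_qconj sqrrN. Qed.
Lemma mul_qconj a : re (a * qconj a) = qnorm a /\ im (a * qconj a) = 0.
Proof. by rewrite reM imM re_qconj im_qconj /qnorm; split; ring. Qed.
Lemma qconjM a b : qconj (a * b) = qconj a * qconj b.
Proof. by apply: iota_inj; rewrite !(re_qconj, im_qconj, reM, imM); ring. Qed.
Lemma qconjD a b : qconj (a + b) = qconj a + qconj b.
Proof. by apply: iota_inj; rewrite !(re_qconj, im_qconj, reD, imD); ring. Qed.
Lemma qconjN a : qconj (- a) = - qconj a.
Proof. by apply: iota_inj; rewrite !(re_qconj, im_qconj, reN, imN); ring. Qed.

(** The complex conjugate of a root of an integer polynomial is a root of the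
    same polynomial. *)
Lemma OK_qconj a : O a -> O (qconj a).
Proof.
move=> [p pm pr]; exists p => //.
have := pr; rewrite -!(fmorph_root iota) -!map_poly_comp /=.
under eq_map_poly => x do rewrite /= rmorph_int.
move=> h.
have -> : iota (qconj a) = (iota a)^*%C.
  by have := im_qconj a; have := re_qconj a; case: (iota a) (iota (qconj a)) => [? ?] [? ?] /= -> ->.
rewrite -complex_root_conj -map_poly_comp.
by under eq_map_poly => x do rewrite /= rmorph_int.
Qed.

Lemma OK_rat_int q : O q%:A -> exists n : int, q = n%:~R.
Proof. exact: (@rat_integral_int K (in_alg K)). Qed.

Lemma OK_real_int a : O a -> im a = 0 -> exists n : int, a = n%:~R.
Proof.
move=> Oa /real_is_rat[q qE]; move: Oa; rewrite qE => /OK_rat_int[n ->].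
by exists n; rewrite scaler_int.
Qed.

Lemma OK_trace a : O a -> exists n : int, 2 * re a = n%:~R.
Proof.
move=> Oa; have /OK_real_int : O (a + qconj a) by apply: OKD => //; exact: OK_qconj.
rewrite imD im_qconj subrr => /(_ erefl)[n nE]; exists n.
by rewrite -re_int -nE reD re_qconj; ring.
Qed.

(** The product of a and its conjugate is an algebraic integer and is rational. *)
Lemma OK_qnorm a : O a -> exists n : nat, qnorm a = n%:R.
Proof.
move=> Oa; have /OK_real_int : O (a * qconj a) by apply: OKM => //; exact: OK_qconj.
have [h1 h2] := mul_qconj a => /(_ h2)[n nE].
have : qnorm a = n%:~R by rewrite -h1 nE re_int.
case: n {nE} => n nE; first by exists n.
by have := qnorm_ge0 a; rewrite nE ler0z.
Qed.

Lemma OK_qnorm_ge1 a : O a -> a != 0 -> 1 <= qnorm a.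
Proof.
move=> /OK_qnorm[[|n] nE] /qnorm_gt0; rewrite nE ?ltxx// => _.
by rewrite ler1n.
Qed.

(** Multiplying a root x of x^2 = t x - d by the denominators of t and d gives an
    algebraic integer. *)
Lemma exists_nonreal_OK : exists2 x : K, O x & 0 < im x.
Proof.
suff [x Ox x0] : exists2 x : K, O x & im x != 0.
  have [lt|gt|eq] := ltgtP 0 (im x); first by exists x.
  - by exists (- x); [exact: OKN|rewrite imN oppr_gt0].
  - by rewrite -eq eqxx in x0.
have [x x0] := exists_nonreal; have [d dE] := quadratic_eq x.
pose t := field_trace x; pose m := denq t * denq d.
have m0 : m != 0 by rewrite mulf_neq0 ?denq_neq0.
exists (m%:~R * x); last by rewrite imM im_int mul0r addr0 re_int mulf_neq0// intr_eq0.
pose T : int := numq t * denq d; pose D : int := numq d * denq t * m.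
exists ('X^2 - T *: 'X + D%:P).
  rewrite -addrA monicE lead_coefDl ?lead_coefXn// size_polyXn.
  rewrite (leq_ltn_trans (size_polyD _ _))// gtn_max size_polyN.
  rewrite (leq_ltn_trans (size_scale_leq _ _)) ?size_polyX//.
  by rewrite (leq_ltn_trans (size_polyC_leq1 _)).
rewrite rmorphD rmorphB /= map_polyZ /= map_polyXn map_polyX map_polyC /=.
rewrite /root !hornerE expr2 mulrACA dE.
have tE : m%:~R * t%:A = T%:~R :> K.
  rewrite -!scaler_int -scalerAl mul1r scalerA -[t in X in X = _]divq_num_den.
  rewrite /m /T !intrM; congr (_ *: _); field.
  by rewrite intr_eq0 denq_neq0.
have dE' : m%:~R * d%:A = (numq d * denq t)%:~R :> K.
  rewrite -!scaler_int -scalerAl mul1r scalerA -[d in X in X = _]divq_num_den.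
  rewrite /m !intrM; congr (_ *: _); field.
  by rewrite intr_eq0 denq_neq0.
have tE' : m%:~R * (t *: x) = T%:~R * x.
  by rewrite -[t *: x]mul1r -scalerAr scalerAl mulrA tE.
rewrite -mulrA mulrBr tE' dE' mulrBr /D [(_ * m)%:~R]intrM.
apply/eqP.
rewrite [X in _ - X](_ : _ = T%:~R * (m%:~R * x)); [ring | by rewrite mulrA].
Qed.

(** For a in O the number (2 Im a)^2 = 4 |a|^2 - tr(a)^2 is a natural number, so
    some w in O has the least positive imaginary part.  Subtracting a multiple of
    w from an element of O leaves an imaginary part in [0, Im w[, hence 0, and
    a real element of O is a rational integer. *)
Lemma exists_omega : exists2 w : K, O w /\ 0 < im w &
  forall a, O a -> exists i j : int, a = i%:~R + j%:~R * w.
Proof.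
have imn a : O a -> exists n : nat, (2 * im a) ^+ 2 = n%:R.
  move=> Oa; have [n nE] := OK_qnorm Oa; have [t tE] := OK_trace Oa.
  have E : (2 * im a) ^+ 2 = (4 * n%:Z - t ^+ 2)%:~R.
    by rewrite rmorphB rmorphM /= rmorphXn /= -tE -pmulrn -nE /qnorm; ring.
  have : 0 <= (4 * n%:Z - t ^+ 2)%:~R :> R by rewrite -E sqr_ge0.
  rewrite ler0z E; case: (4 * _ - _) => // k _; by exists k.
pose P n := `[< exists a, [/\ O a, 0 < im a & (2 * im a) ^+ 2 = n%:R] >].
have exP : exists n, P n.
  have [x Ox x0] := exists_nonreal_OK; have [n nE] := imn x Ox.
  by exists n; apply/asboolP; exists x.
have [n /asboolP[w [Ow w0 wE]] nmin] := ex_minnP exP.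
exists w => // a Oa; pose j := Num.floor (im a / im w).
pose b := a - j%:~R * w.
have Ob : O b by apply: OKB => //; apply: OKM => //; exact: OK_int.
have imb : im b = im a - j%:~R * im w.
  by rewrite imD imN imM im_int mul0r addr0 re_int.
have b0 : im b = 0.
  apply/eqP; rewrite eq_le; apply/andP; split; last first.
    by rewrite imb subr_ge0 -ler_pdivlMr// ge_floor.
  rewrite leNgt; apply/negP => b0; have [k kE] := imn _ Ob.
  have : P k by apply/asboolP; exists b.
  move/nmin; rewrite -(ler_nat R) -wE -kE ler_sqr ?nnegrE; [|exact: mulr_ge0 (ltW w0)|exact: mulr_ge0 (ltW b0)].
  rewrite ler_pM2l// leNgt imb ltrBlDr -{1}[im w]mul1r -mulrDl -ltr_pdivrMr//.
  by have := floorD1_gt (im a / im w); rewrite rmorphD /= addrC => ->.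
have [i iE] := OK_real_int Ob b0; exists i, j.
by rewrite -iE /b subrK.
Qed.

End QuadraticField.

(** * The discriminant as an area *)

(** As the dimension of K is not the numeral 2, the two indices are recognized by
    their values. *)
Lemma big_dim2 (F : nmodType) (n : nat) (f : 'I_n -> F) (i0 i1 : 'I_n) :
  n = 2 -> i0 = 0 :> nat -> i1 = 1 :> nat -> \sum_i f i = f i0 + f i1.
Proof.
move=> n2; subst n => h0 h1; rewrite !big_ord_recl big_ord0 addr0.
by congr (f _ + f _); apply: val_inj; rewrite /= ?h0 ?h1.
Qed.

Lemma det_dim2 (F : comNzRingType) (n : nat) (A : 'M[F]_n) (i0 i1 : 'I_n) :
  n = 2 -> i0 = 0 :> nat -> i1 = 1 :> nat ->
  \det A = A i0 i0 * A i1 i1 - A i0 i1 * A i1 i0.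
Proof.
move=> n2; subst n => h0 h1.
rewrite (expand_det_row _ i0) (big_dim2 _ _ h0 h1)// /cofactor !det_mx11 !mxE.
rewrite h0 h1 /= expr0 expr1 mul1r mulN1r mulrN.
have -> : lift i0 0 = i1 by apply: val_inj; rewrite /= h0 h1.
by have -> : lift i1 0 = i0 by apply: val_inj; rewrite /= h0 h1.
Qed.

Section Disc.
Variables (R : realType) (K : fieldExtType rat).
Variable iota : {rmorphism K -> complex R}.
Local Notation re a := (complex.Re (iota a)).
Local Notation im a := (complex.Im (iota a)).
Local Notation O := (@ring_of_integers K).
Hypothesis hIQ : imaginary_quadratic iota.

Let i0 : 'I_(\dim {:K}) := cast_ord (esym (dimK hIQ)) ord0.
Let i1 : 'I_(\dim {:K}) := cast_ord (esym (dimK hIQ)) ord_max.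

(** The trace form is 2 Re(u v), of signature (1, 1) on the complex plane: hence
    the sign, and the square of twice the area spanned by the basis. *)
Lemma basis_disc_covol (w : (\dim {:K}).-tuple K) :
  ratr (basis_disc w) =
  - (2 * (re (tnth w i0) * im (tnth w i1) - im (tnth w i0) * re (tnth w i1))) ^+ 2.
Proof.
rewrite /basis_disc (@det_dim2 _ _ _ i0 i1 (dimK hIQ))// !mxE.
rewrite rmorphB !rmorphM /= !(field_traceE hIQ) !reM; ring.
Qed.

Variable w : K.
Hypotheses (Ow : O w) (w0 : 0 < im w).
Hypothesis Obas : forall a, O a -> exists i j : int, a = i%:~R + j%:~R * w.

Lemma exists_integral_basis : exists v : (\dim {:K}).-tuple K, integral_basis v.
Proof.
have sz : size [:: 1; w] == \dim {:K} by rewrite (dimK hIQ).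
exists (Tuple sz); split; first by apply: (basis_1x hIQ); rewrite gt_eqF.
apply/seteqP; split => [a /Obas[i [j ->]]|_ [c _ <-]].
  exists [ffun k : 'I_(\dim {:K}) => if k == 0 :> nat then i else j] => //.
  rewrite (@big_dim2 _ _ _ i0 i1 (dimK hIQ))// !ffunE /= !(tnth_nth 0) /=.
  by rewrite mulrzl.
rewrite (@big_dim2 _ _ _ i0 i1 (dimK hIQ))// !(tnth_nth 0) /=.
by apply: OKD; apply: OK_mulz => //; exact: OK1.
Qed.

(** An integral basis and [1; w] are expressed in each other with integer
    coefficients, so each of the areas they span is an integer multiple of the
    other. *)
Lemma sqrt_disc : Num.sqrt `|ratr (field_disc K)| = 2 * im w :> R.
Proof.
pose P := [set d | exists2 w : (\dim {:K}).-tuple K, integral_basis w & d = basis_disc w].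
have exP : exists d, P d.
  by have [v vb] := exists_integral_basis; exists (basis_disc v), v.
have [v [vb vO] dE] : P (field_disc K) by apply: xgetPex.
rewrite dE basis_disc_covol.
set v0 := tnth v i0; set v1 := tnth v i1; set D := _ - _.
have inO a : O a <-> exists i j : int, a = v0 *~ i + v1 *~ j.
  rewrite {1}vO; split => [[c _ <-]|[i [j ->]]].
    by rewrite (@big_dim2 _ _ _ i0 i1 (dimK hIQ))//; exists (c i0), (c i1).
  exists [ffun k : 'I_(\dim {:K}) => if k == 0 :> nat then i else j] => //.
  by rewrite (@big_dim2 _ _ _ i0 i1 (dimK hIQ))// !ffunE.
have intz (u : K) (i : int) : re (u *~ i) = re u * i%:~R /\ im (u *~ i) = im u * i%:~R.
  by rewrite -mulrzr reM imM re_int im_int; split; ring.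
have reint (u : K) (i j : int) : re (i%:~R + j%:~R * u) = i%:~R + j%:~R * re u.
  by rewrite reD reM re_int re_int im_int; ring.
have imint (u : K) (i j : int) : im (i%:~R + j%:~R * u) = j%:~R * im u.
  by rewrite imD imM re_int im_int im_int; ring.
have [m mE] : exists m : int, D = m%:~R * im w.
  have /Obas[p [q pq]] : O v0 by apply/inO; exists 1, 0; rewrite mulr0z addr0 mulr1z.
  have /Obas[r [s rs]] : O v1 by apply/inO; exists 0, 1; rewrite mulr0z add0r mulr1z.
  exists (p * s - q * r); rewrite /D pq rs !reint !imint.
  by rewrite rmorphB !rmorphM /=; ring.
have [m' m'E] : exists m : int, im w = m%:~R * D.
  have [p [q pq]] := (inO _).1 Ow.
  have [r [s rs]] := (inO _).1 (@OK1 K).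
  exists (r * q - s * p).
  transitivity (re 1 * im w - im 1 * re w); first by rewrite re1 im1; ring.
  rewrite pq rs !(reD, imD) !(intz _ _).1 !(intz _ _).2 /D.
  by rewrite rmorphB !rmorphM /=; ring.
have mm : m' * m = 1.
  have /eqP := m'E; rewrite mE mulrA -{1}[im w]mul1r -intrM -subr_eq0 -mulrBl.
  rewrite mulf_eq0 (gt_eqF w0) orbF subr_eq0 => /eqP h.
  by apply: (@intr_inj R); rewrite -h.
have m1 : `|m| = 1.
  have /eqP : absz (m' * m) = 1%N by rewrite mm.
  by rewrite abszM muln_eq1 => /andP[_ /eqP h]; rewrite -abszE h.
rewrite normrN normrX sqrtr_sqr normr_id normrM (@ger0_norm _ 2)//; congr (_ * _).
by rewrite mE normrM -intr_norm m1 mul1r gtr0_norm.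
Qed.

End Disc.

(** * Residue classes modulo principal ideals *)

Lemma ncard_seq (T : choiceType) (A : set T) (s : seq T) :
  uniq s -> (forall x, A x <-> x \in s) -> ncard A = size s.
Proof.
move=> us As; rewrite /ncard.
have -> : A = [set` [fset x in s]%fset].
  by apply/seteqP; split => x /=; rewrite inE => /As.
by rewrite set_fsetK card_fseq undup_id.
Qed.

Section Index.
Variable K : fieldExtType rat.
Implicit Types (I A P Q : set K) (S : seq (set K)).
Local Notation O := (@ring_of_integers K).
Local Notation PI := principal_ideal.

Lemma principal_is_ideal a : O a -> is_ideal (PI a).
Proof.
move=> Oa; split.
- by move=> _ [b Ob <-]; exact: OKM.
- by exists 0; [exact: OK0|rewrite mulr0].
- by move=> _ _ [x Ox <-] [y Oy <-]; exists (x + y); [exact: OKD|rewrite mulrDr].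
- by move=> c _ Oc [x Ox <-]; exists (c * x); [exact: OKM|rewrite mulrCA].
Qed.

Lemma idealB I x y : is_ideal I -> I x -> I y -> I (x - y).
Proof.
move=> [_ _ ID IM] Ix Iy; apply: ID => //; rewrite -mulN1r.
by apply: IM => //; apply: OKN; exact: OK1.
Qed.
Lemma idealD I x y : is_ideal I -> I x -> I y -> I (x + y).
Proof. by move=> [_ _ ID IM]; exact: ID. Qed.
Lemma ideal_sub I x : is_ideal I -> I x -> O x.
Proof. by move=> [h _ _ _] /h. Qed.
Lemma idealMl I a x : is_ideal I -> O a -> I x -> I (a * x).
Proof. by move=> [_ _ _ h]; exact: h. Qed.
Lemma idealMr I a x : is_ideal I -> O a -> I x -> I (x * a).
Proof. by rewrite mulrC; exact: idealMl. Qed.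
Lemma ideal0 I : is_ideal I -> I 0.
Proof. by case. Qed.
Lemma idealBC I x y : is_ideal I -> I (x - y) -> I (y - x).
Proof. by move=> hI h; rewrite -opprB -sub0r; apply: idealB => //; exact: ideal0. Qed.
Lemma PI_id (a : K) : PI a a.
Proof. by exists 1; [exact: OK1|rewrite mulr1]. Qed.
Lemma PI_sub I a : is_ideal I -> I a -> PI a `<=` I.
Proof. by move=> hI Ia _ [b Ob <-]; exact: idealMr. Qed.
Lemma PI_eq0 a : O a -> PI a = [set 0] -> a = 0.
Proof. by move=> Oa h; have := PI_id a; rewrite h. Qed.

Lemma icoset_eq I x y : is_ideal I -> icoset I x = icoset I y <-> I (x - y).
Proof.
move=> hI; split => [h|h].
  have : icoset I x x by exists 0; [exact: ideal0|rewrite addr0].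
  by rewrite h => -[z Iz <-]; rewrite addrC addKr.
apply/seteqP; split => _ [z Iz <-].
  by exists (z + (x - y)); [exact: idealD|ring].
exists (z - (x - y)); [exact: idealB|ring].
Qed.

(** It is N(I) if A is the ring of integers, and the value of Euler's function at
    I if A consists of the elements prime to I; the intermediate sets A occur when
    one prime after the other is taken into account. *)
Definition ncosets I A : nat := ncard [set icoset I x | x in A].

Definition reps I A (s : seq K) :=
  [/\ uniq s, forall x, x \in s -> A x,
      forall x y, x \in s -> y \in s -> I (x - y) -> x = y &
      forall x, A x -> exists2 y, y \in s & I (x - y)].

Lemma ncosets_reps I A s : is_ideal I -> reps I A s -> ncosets I A = size s.
Proof.
move=> hI [us sA sinj scov]; rewrite /ncosets -(size_map (icoset I)).
apply: ncard_seq.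
  rewrite map_inj_in_uniq// => x y xs ys /(icoset_eq _ _ hI); exact: sinj.
move=> c; split => [[x /scov[y ys Ixy] <-]|/mapP[x xs ->]].
  by apply/mapP; exists y => //; apply/(icoset_eq _ _ hI).
by exists x => //; exact: sA.
Qed.

(** The list L only serves to show that finitely many classes occur; its members
    need not lie in A. *)
Lemma exists_reps I A (L : seq K) : is_ideal I ->
  (forall x, A x -> exists2 y, y \in L & I (x - y)) -> exists s, reps I A s.
Proof.
move=> hI AL.
have fin : finite_set [set icoset I x | x in A].
  apply: (@sub_finite_set _ _ [set` map (icoset I) L]); last exact: finite_seq.
  move=> _ [x /AL[y yL Ixy] <-] /=; apply/mapP; exists y => //.
  exact/(icoset_eq _ _ hI).
have /finite_seqP[cs csE] := fin.
have [r rP] : exists r : set K -> K, forall c, c \in cs -> A (r c) /\ icoset I (r c) = c.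
  have h c : exists x, c \in cs -> A x /\ icoset I x = c.
    have [/asboolP|_] := boolP (c \in cs); last by exists 0.
    move=> /asboolP ccs; have : [set` cs] c by [].
    by rewrite -csE => -[x Ax xc]; exists x.
  by exists (fun c => sval (cid (h c))) => c; exact: svalP (cid (h c)).
pose s := map r (undup cs); exists s; split.
- rewrite map_inj_in_uniq ?undup_uniq// => c d; rewrite !mem_undup => cc dc h.
  by rewrite -(rP c cc).2 -(rP d dc).2 h.
- by move=> x /mapP[c]; rewrite mem_undup => /rP[? _] ->.
- move=> _ _ /mapP[c cc ->] /mapP[d dd ->] /(icoset_eq _ _ hI).
  by rewrite !mem_undup in cc dd; rewrite (rP c cc).2 (rP d dd).2 => ->.
- move=> x Ax; have xc : icoset I x \in cs.
    have : [set icoset I x | x in A] (icoset I x) by exists x.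
    by rewrite csE.
  exists (r (icoset I x)); first by apply: map_f; rewrite mem_undup.
  by apply/(icoset_eq _ _ hI); rewrite (rP _ xc).2.
Qed.

Lemma reps_cat I A1 A2 s1 s2 : is_ideal I ->
  (forall x y, A1 x -> A2 y -> ~ I (x - y)) ->
  reps I A1 s1 -> reps I A2 s2 -> reps I (A1 `|` A2) (s1 ++ s2).
Proof.
move=> hI dis [u1 m1 i1 c1] [u2 m2 i2 c2]; split.
- rewrite cat_uniq u1 u2 andbT /=; apply/hasPn => x x2; apply/negP => x1.
  by apply: (dis x x); [exact: m1|exact: m2|rewrite subrr; exact: ideal0].
- by move=> x; rewrite mem_cat => /orP[/m1|/m2]; [left|right].
- move=> x y; rewrite !mem_cat => /orP[xs|xs] /orP[ys|ys].
  + exact: i1.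
  + by move=> /(dis _ _ (m1 _ xs) (m2 _ ys)).
  + by move=> /(idealBC hI) /(dis _ _ (m1 _ ys) (m2 _ xs)).
  + exact: i2.
- by move=> x [/c1|/c2] [y ys Ixy]; exists y; rewrite // mem_cat ys ?orbT.
Qed.

Lemma reps_scale a b A s : O a -> O b -> a != 0 -> reps (PI b) A s ->
  reps (PI (a * b)) [set a * x | x in A] (map ( *%R a) s).
Proof.
move=> Oa Ob a0 [u m i c].
have mulI := mulfI a0.
split.
- by rewrite map_inj_uniq.
- by move=> _ /mapP[x xs ->]; exists x => //; exact: m.
- move=> _ _ /mapP[x xs ->] /mapP[y ys ->] [z Oz].
  by rewrite -mulrBr -mulrA => /mulI h; congr (_ * _); apply: i => //; exists z.
- move=> _ [x /c[y ys [z Oz zE]] <-]; exists (a * y); first exact: map_f.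
  by exists z => //; rewrite -mulrBr -zE mulrA.
Qed.

(** A residue modulo a b is determined by its residue modulo a and by the residue
    modulo b of the quotient. *)
Lemma reps_mul a b s t : O a -> O b -> a != 0 ->
  reps (PI a) O s -> reps (PI b) O t ->
  reps (PI (a * b)) O [seq x + a * y | x <- s, y <- t].
Proof.
move=> Oa Ob a0 [us ms iS cs] [ut mt it ct].
have key x y x' y' : x \in s -> y \in t -> x' \in s -> y' \in t ->
  PI (a * b) (x + a * y - (x' + a * y')) -> x = x' /\ y = y'.
  move=> xs yt x's y't [z Oz zE].
  have xx : x = x'.
    apply: iS => //; exists (b * z - (y - y')).
      by apply: OKB; [exact: OKM|apply: OKB; exact: mt].
    by rewrite mulrBr mulrA zE; ring.
  split=> //; apply: it => //; exists z => //; apply: (mulfI a0).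
  by rewrite mulrA zE xx; ring.
split.
- apply: allpairs_uniq => // -[x y] [x' y'] /allpairsP[[x1 y1] /= [x1s y1t [-> ->]]].
  move=> /allpairsP[[x2 y2] /= [x2s y2t [-> ->]]] h.
  have [|-> ->//] := key _ _ _ _ x1s y1t x2s y2t.
  by rewrite h subrr; exact: ideal0 (principal_is_ideal (OKM Oa Ob)).
- move=> _ /allpairsP[[x y] /= [xs yt ->]].
  by apply: OKD; [exact: ms|apply: OKM => //; exact: mt].
- move=> _ _ /allpairsP[[x y] /= [xs yt ->]] /allpairsP[[x' y'] /= [xs' yt' ->]].
  by move=> /key [//|//|//|//|-> ->].
- move=> u /cs[x xs [v /ct[y yt [w Ow wE]] vE]].
  exists (x + a * y); first by apply/allpairsP; exists (x, y).
  by exists w => //; rewrite -mulrA wE mulrBr vE; ring.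
Qed.

Variables (R : realType) (iota : {rmorphism K -> complex R}).
Hypothesis hIQ : imaginary_quadratic iota.
Local Notation re a := (complex.Re (iota a)).
Local Notation im a := (complex.Im (iota a)).
Local Notation qnorm := (qnorm iota).
Local Notation qconj := (@qconj K).

Lemma reps_qconj a s : O a -> reps (PI a) O s -> reps (PI (qconj a)) O (map qconj s).
Proof.
move=> Oa [u m i c]; have conjI := can_inj (qconjK hIQ).
split.
- by rewrite map_inj_uniq.
- by move=> _ /mapP[x /m Ox ->]; exact: (OK_qconj hIQ).
- move=> _ _ /mapP[x xs ->] /mapP[y ys ->] [z Oz zE]; congr qconj; apply: i => //.
  exists (qconj z); first exact: (OK_qconj hIQ).
  by apply: conjI; rewrite (qconjM hIQ) (qconjK hIQ) zE (qconjD hIQ) (qconjN hIQ).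
- move=> x Ox; have [y ys [z Oz zE]] := c _ (OK_qconj hIQ Ox).
  exists (qconj y); first exact: map_f.
  exists (qconj z); first exact: (OK_qconj hIQ).
  by apply: conjI; rewrite -(qconjM hIQ) zE !(qconjK hIQ) (qconjD hIQ) (qconjN hIQ) !(qconjK hIQ).
Qed.

Lemma reps_nat n : (0 < n)%N -> exists s, reps (PI n%:R) O s /\ size s = (n * n)%N.
Proof.
move=> n0; have [w [Ow w0] Obas] := exists_omega hIQ.
pose f (i j : nat) : K := i%:R + j%:R * w.
have On k : O (k%:R) by exact: (OK_int _ k).
have redn (i : int) : exists2 k : nat, (k < n)%N & exists m : int, i%:~R = k%:R + n%:R * m%:~R :> K.
  exists `|(i %% n)%Z|%N.
    by rewrite -ltz_nat gez0_abs ?modz_ge0 ?ltz_pmod//; lia.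
  exists (i %/ n)%Z; rewrite {1}(divz_eq i n) intrD intrM addrC mulrC.
  congr (_ + _); rewrite -[in LHS](@gez0_abs (i %% n)%Z) ?modz_ge0//; lia.
have key i j i' j' : (i < n)%N -> (j < n)%N -> (i' < n)%N -> (j' < n)%N ->
  PI n%:R (f i j - f i' j') -> i = i' /\ j = j'.
  move=> li lj li' lj' [z /Obas[p [q ->]] zE].
  have nR k : n%:R * k%:~R = (n%:Z * k)%:~R :> R by rewrite rmorphM.
  have E1 : im (n%:R * (p%:~R + q%:~R * w)) = (n%:Z * q)%:~R * im w.
    rewrite imM -[n%:R]/((n%:Z)%:~R) re_int im_int imD imM re_int !im_int.
    by rewrite rmorphM /=; ring.
  have E2 : im (f i j - f i' j') = (j%:Z - j'%:Z)%:~R * im w.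
    rewrite /f -[i%:R]/(i%:Z%:~R) -[j%:R]/(j%:Z%:~R) -[i'%:R]/(i'%:Z%:~R) -[j'%:R]/(j'%:Z%:~R).
    by rewrite imD imN !imD !imM !re_int !im_int rmorphB /=; ring.
  have jj : n%:Z * q = j%:Z - j'%:Z.
    apply: (@intr_inj R); apply: (mulIf (lt0r_neq0 w0)).
    by rewrite -E1 -E2 zE.
  have small (u v : nat) (t : int) : (u < n)%N -> (v < n)%N -> n%:Z * t = u%:Z - v%:Z -> u = v.
    by move=> ? ? ?; have [t0|t0|t0] := ltgtP t 0; nia.
  have jj' : j = j' by exact: small jj.
  have E3 : re (n%:R * (p%:~R + q%:~R * w)) = (n%:Z * p)%:~R + (n%:Z * q)%:~R * re w.
    rewrite reM -[n%:R]/((n%:Z)%:~R) !re_int !im_int reD reM !re_int im_int.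
    by rewrite !rmorphM /=; ring.
  have E4 : re (f i j - f i' j') = (i%:Z - i'%:Z)%:~R + (j%:Z - j'%:Z)%:~R * re w.
    rewrite /f -[i%:R]/(i%:Z%:~R) -[j%:R]/(j%:Z%:~R) -[i'%:R]/(i'%:Z%:~R) -[j'%:R]/(j'%:Z%:~R).
    by rewrite reD reN !reD !reM !re_int !im_int !rmorphB /=; ring.
  have ii : n%:Z * p = i%:Z - i'%:Z.
    apply: (@intr_inj R); apply: (addIr ((n%:Z * q)%:~R * re w)).
    by rewrite -E3 zE E4 jj.
  by split=> //; exact: small ii.
exists [seq f i j | i <- seq.iota 0 n, j <- seq.iota 0 n]; split; last first.
  by rewrite size_allpairs size_iota.
have m0 i : (i \in seq.iota 0 n) = (i < n)%N by rewrite mem_iota.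
split.
- apply: allpairs_uniq; rewrite ?iota_uniq// => -[i j] [i' j'].
  move=> /allpairsP[[i1 j1] /= []]; rewrite !m0 => ? ? [-> ->].
  move=> /allpairsP[[i2 j2] /= []]; rewrite !m0 => ? ? [-> ->] h.
  have [//|//|//|//||-> ->//] := key i1 j1 i2 j2.
  by rewrite h subrr; exists 0; [exact: OK0|rewrite mulr0].
- move=> _ /allpairsP[[i j] /= [_ _ ->]].
  by apply: OKD => //; exact: OKM.
- move=> _ _ /allpairsP[[i j] /= [+ + ->]] /allpairsP[[i' j'] /= [+ + ->]].
  by rewrite !m0 => ? ? ? ? /key [//|//|//|//|-> ->].
- move=> x /Obas[p [q ->]].
  have [k kn [m ->]] := redn p; have [l ln [m' ->]] := redn q.
  exists (f k l); first by apply/allpairsP; exists (k, l); rewrite /= !m0.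
  exists (m%:~R + m'%:~R * w); last by rewrite /f; ring.
  by apply: OKD; [exact: OK_int|apply: OKM => //; exact: OK_int].
Qed.

Lemma mul_qconj_nat a n : qnorm a = n%:R -> a * qconj a = n%:R.
Proof.
move=> nE; have [h1 h2] := mul_qconj hIQ a; apply: (iota_inj (iota := iota)).
  by rewrite h1 nE -[n%:R in RHS]/(n%:Z%:~R) re_int.
by rewrite h2 -[n%:R]/(n%:Z%:~R) im_int.
Qed.

(** Multiples of |a|^2 are multiples of a, and O has finitely many classes modulo
    a positive integer. *)
Lemma PI_cover a : O a -> a != 0 ->
  exists L : seq K, forall x, O x -> exists2 y, y \in L & PI a (x - y).
Proof.
move=> Oa a0; have [n nE] := OK_qnorm hIQ Oa.
have n0 : (0 < n)%N by rewrite -(ltr_nat R) -nE qnorm_gt0.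
have [L [[_ _ _ cov] _]] := reps_nat n0; exists L => x /cov[y yL [z Oz zE]].
exists y => //; exists (qconj a * z); first by apply: OKM => //; exact: OK_qconj hIQ _ Oa.
by rewrite mulrA (mul_qconj_nat nE) zE.
Qed.

Lemma PI_reps a A : O a -> a != 0 -> A `<=` O -> exists s, reps (PI a) A s.
Proof.
move=> Oa a0 AO; have [L cov] := PI_cover Oa a0.
apply: exists_reps (principal_is_ideal Oa) _ => x /AO; exact: cov.
Qed.

(** Conjugation shows that a and its conjugate have the same index.  The product
    of the two indices is that of the integer n = |a|^2, which is n^2. *)
Lemma ncosets_PI a : O a -> a != 0 -> (ncosets (PI a) O)%:R = qnorm a.
Proof.
move=> Oa a0; have [n nE] := OK_qnorm hIQ Oa.
have n0 : (0 < n)%N by rewrite -(ltr_nat R) -nE qnorm_gt0.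
have hI := principal_is_ideal Oa.
have [s sr] := PI_reps Oa a0 (@subset_refl _ O).
have Oc := OK_qconj hIQ Oa.
have := reps_mul Oa Oc a0 sr (reps_qconj Oa sr); rewrite (mul_qconj_nat nE) => r1.
have [L [r2 Lsz]] := reps_nat n0.
have hn : is_ideal (PI (n%:R : K)) by apply: principal_is_ideal; exact: (OK_int _ n).
have := ncosets_reps hn r1; rewrite (ncosets_reps hn r2) Lsz size_allpairs size_map.
move=> h; rewrite (ncosets_reps hI sr) nE; congr (_%:R).
by apply/eqP; rewrite -eqn_sqr -!mulnn h.
Qed.

Lemma ideal_norm_PI a : O a -> a != 0 -> (ideal_norm (PI a))%:R = qnorm a.
Proof. exact: ncosets_PI. Qed.

Lemma ideal_norm_O : ideal_norm O = 1%N.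
Proof.
have -> : O = PI 1.
  by apply/seteqP; split => [x Ox|_ [x Ox <-]]; [exists x|]; rewrite ?mul1r.
by apply/eqP; rewrite -(eqr_nat R) ideal_norm_PI ?oner_eq0 ?qnorm1//; exact: OK1.
Qed.

Lemma qnorm1_unit u : O u -> qnorm u = 1 -> exists2 v, O v & u * v = 1.
Proof.
move=> Ou u1; exists (qconj u); first exact: OK_qconj hIQ _ Ou.
exact: (@mul_qconj_nat u 1 u1).
Qed.

Lemma ideal_1 I : is_ideal I -> I 1 -> I = O.
Proof.
move=> hI I1; apply/seteqP; split=> [x /(ideal_sub hI)//|x Ox].
by rewrite -[x]mulr1; exact: idealMl.
Qed.

Lemma ideal_unit I u : is_ideal I -> O u -> I u -> qnorm u = 1 -> I = O.
Proof.
move=> hI Ou Iu /(qnorm1_unit Ou)[v Ov uv]; apply: (ideal_1 hI).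
by rewrite -uv; exact: idealMr.
Qed.

(** * Prime ideals and Euler's function *)

Hypothesis hP : principal_ring_of_integers K.

Lemma nonzero_gen I : nonzero_ideal I -> exists a, [/\ O a, a != 0 & I = PI a].
Proof.
move=> [hI I0]; have [a Oa aE] := hP hI; exists a; split => //.
apply/eqP => a0; apply: I0; rewrite aE a0; apply/seteqP; split.
  by move=> _ [b Ob <-]; rewrite mul0r.
by move=> _ ->; exact: PI_id.
Qed.

Lemma PI_nonzero a : O a -> a != 0 -> nonzero_ideal (PI a).
Proof.
move=> Oa a0; split; first exact: principal_is_ideal.
by move=> /(PI_eq0 Oa) h; rewrite h eqxx in a0.
Qed.

Lemma ideal_pair a b : O a -> O b ->
  is_ideal [set x | exists u v, [/\ O u, O v & x = a * u + b * v]].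
Proof.
move=> Oa Ob; split.
- by move=> _ [u [v [Ou Ov ->]]]; apply: OKD; exact: OKM.
- by exists 0, 0; split; rewrite ?mulr0 ?addr0//; exact: OK0.
- move=> _ _ [u [v [Ou Ov ->]]] [u' [v' [Ou' Ov' ->]]].
  by exists (u + u'), (v + v'); split; [exact: OKD|exact: OKD|ring].
- move=> c _ Oc [u [v [Ou Ov ->]]].
  by exists (c * u), (c * v); split; [exact: OKM|exact: OKM|ring].
Qed.

(** Among the nonunits that divide a generator of I, one of least norm, q,
    generates a prime ideal.  Indeed let q divide x y, and let e generate qO + xO.
    If e is a unit, then q divides y by Bezout.  Otherwise e is an associate of q
    by minimality, so q divides x. *)
Lemma exists_prime_sup I : nonzero_ideal I -> I <> O ->
  exists2 P, nonzero_prime_ideal P & I `<=` P.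
Proof.
move=> nI IO; have [d [Od d0 dE]] := nonzero_gen nI.
pose B n := `[< exists q, [/\ O q, q != 0, qnorm q <> 1, PI q d & qnorm q = n%:R] >].
have exB : exists n, B n.
  have [n nE] := OK_qnorm hIQ Od; exists n; apply/asboolP; exists d; split=> //.
    by move=> d1; apply: IO; apply: (@ideal_unit _ d); rewrite ?dE//;
      [exact: principal_is_ideal|exact: PI_id].
  exact: PI_id.
have [n /asboolP[q [Oq q0 q1 qd qn]] nmin] := ex_minnP exB.
have hq := principal_is_ideal Oq.
exists (PI q); last by rewrite dE; exact: PI_sub.
split; first exact: PI_nonzero.
  move=> qO; have [v Ov qv] : PI q 1 by rewrite qO; exact: OK1.
  apply: q1; apply/eqP; rewrite eq_le (OK_qnorm_ge1 hIQ)// andbT.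
  have : qnorm q * qnorm v = 1 by rewrite -qnormM qv qnorm1.
  have v0 : v != 0 by apply/eqP => v0; move/eqP: qv; rewrite v0 mulr0 eq_sym oner_eq0.
  by move=> <-; rewrite ler_peMr ?qnorm_ge0// (OK_qnorm_ge1 hIQ).
move=> x y Ox Oy qxy.
have [e Oe eE] := hP (ideal_pair Oq Ox).
have [f Of fE] : PI e q.
  by rewrite -eE; exists 1, 0; split; [exact: OK1|exact: OK0|ring].
have e0 : e != 0 by apply: contraNneq q0 => e0; rewrite -fE e0 mul0r.
have f0 : f != 0 by apply: contraNneq q0 => f0; rewrite -fE f0 mulr0.
have [e1|e1] := pselect (qnorm e = 1).
  right; have [w Ow ew] := qnorm1_unit Oe e1.
  have [u [v [Ou Ov uvE]]] : [set x' | exists u v, [/\ O u, O v & x' = q * u + x * v]] 1.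
    by rewrite eE; exists w.
  rewrite -[y]mul1r uvE mulrDl; apply: idealD => //.
    by rewrite -mulrA; exists (u * y) => //; exact: OKM.
  by rewrite mulrAC; apply: idealMr.
left; have [m mE] := OK_qnorm hIQ Oe.
have : B m.
  apply/asboolP; exists e; split=> //; case: qd => [z Oz <-]; rewrite -fE.
  by exists (f * z); [exact: OKM|rewrite mulrA].
move=> /nmin; rewrite -(ler_nat R) -qn -mE -fE qnormM -[leRHS]mulr1.
rewrite ler_pM2l ?qnorm_gt0// => f1.
have /(qnorm1_unit Of)[w Ow fw] : qnorm f = 1 by apply/eqP; rewrite eq_le f1 (OK_qnorm_ge1 hIQ).
have [z Oz zx] : PI e x by rewrite -eE; exists 0, 1; split; [exact: OK0|exact: OK1|ring].
exists (w * z); first exact: OKM.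
by rewrite -zx mulrA -[e * f * w]mulrA fw mulr1.
Qed.

Section Prime.
Variable P : set K.
Hypothesis pP : nonzero_prime_ideal P.

Lemma prime_is_ideal : is_ideal P. Proof. by case: pP => -[]. Qed.

Lemma prime_gen : exists p, [/\ O p, p != 0, P = PI p, qnorm p = (ideal_norm P)%:R & 2 <= qnorm p].
Proof.
case: pP => nP PO _; have [p [Op p0 pE]] := nonzero_gen nP.
have NP : qnorm p = (ideal_norm P)%:R by rewrite pE ideal_norm_PI.
exists p; split=> //; have := OK_qnorm_ge1 hIQ Op p0.
rewrite NP ler1n (ler_nat R 2) leq_eqVlt => /orP[/eqP N1|//].
exfalso; apply: PO; apply: (@ideal_unit _ p) => //; first exact: prime_is_ideal.
  by rewrite pE; exact: PI_id.
by rewrite NP -N1.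
Qed.

Lemma primeM x y : O x -> O y -> P (x * y) -> P x \/ P y.
Proof. by case: pP => _ _; exact. Qed.

(** Two different nonzero primes of a principal ring do not contain each other:
    if p = q u lies in Q = qO, then P contains q or u; the first gives P = Q and
    the second makes q a unit. *)
Lemma prime_neq p Q : nonzero_prime_ideal Q -> Q <> P -> O p -> P = PI p -> ~ Q p.
Proof.
move=> pQ QP Op PE Qp; have [hQ QO] : is_ideal Q /\ Q <> O by case: pQ => -[].
have hPi := prime_is_ideal.
have PQ : P `<=` Q by rewrite PE; exact: PI_sub.
have [q [Oq q0 qE]] : exists q, [/\ O q, q != 0 & Q = PI q] by case: pQ => /nonzero_gen.
have [u Ou uE] : PI q p by rewrite -qE.
have : P (q * u) by rewrite uE PE; exact: PI_id.
move=> /(primeM Oq Ou)[Pq|].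
  by apply: QP; apply/seteqP; split => //; rewrite qE; exact: PI_sub.
rewrite PE => -[v Ov vE]; apply: QO; apply: (ideal_1 hQ).
rewrite qE; exists v => //.
have p0 : p != 0.
  by apply/eqP => p0; move: uE => /eqP; case: pP => -[_ +] _ _; rewrite PE p0 => h;
     exfalso; apply: h; apply/seteqP; split => [_ [b _ <-]|_ ->]; [rewrite mul0r|exact: PI_id].
by apply: (mulfI p0); rewrite mulr1 mulrCA vE.
Qed.

End Prime.

Definition coprime_to S : set K := [set x | O x /\ forall P, P \in S -> ~ P x].

(** By induction on S.  Modulo a = p b, where P = pO, the elements prime to S are
    those prime to [P :: S] and the p y with y prime to S, and the latter
    correspond to the residues prime to S modulo b.  So the count for [P :: S] is
    that for S multiplied by 1 - |b|^2 / |a|^2 = 1 - 1/N(P). *)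
Lemma ncosets_coprime S a : uniq S -> (forall P, P \in S -> nonzero_prime_ideal P) ->
  O a -> a != 0 -> (forall P, P \in S -> P a) ->
  (ncosets (PI a) (coprime_to S))%:R = qnorm a * \prod_(P <- S) (1 - (ideal_norm P)%:R^-1).
Proof.
elim: S a => [|P S IH] a /=.
  move=> _ _ Oa a0 _; rewrite big_nil mulr1 -ncosets_PI//; congr (ncosets _ _)%:R.
  by apply/seteqP; split => [x []//|x Ox]; split.
move=> /andP[PS uS] prS Oa a0 aS.
have pP : nonzero_prime_ideal P by apply: prS; rewrite mem_head.
have prS' Q : Q \in S -> nonzero_prime_ideal Q by move=> QS; apply: prS; rewrite in_cons QS orbT.
have [p [Op p0 PE Np _]] := prime_gen pP.
have hPi := prime_is_ideal pP.
have [b Ob bE] : PI p a by rewrite -PE; apply: aS; rewrite mem_head.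
have b0 : b != 0 by apply: contraNneq a0 => b0; rewrite -bE b0 mulr0.
have Qp Q : Q \in S -> ~ Q p.
  by move=> QS; apply: (@prime_neq P) => //; [exact: prS'|move=> QP; rewrite -QP QS in PS].
have bS Q : Q \in S -> Q b.
  move=> QS; have : Q a by apply: aS; rewrite in_cons QS orbT.
  by rewrite -bE => /(primeM (prS' _ QS) Op Ob)[/(Qp _ QS)|].
have hI := principal_is_ideal Oa.
have [s1 r1] := PI_reps Oa a0 (fun x (h : coprime_to (P :: S) x) => h.1).
have [s2 r2] := PI_reps Ob b0 (fun x (h : coprime_to S x) => h.1).
have r2' := reps_scale Op Ob p0 r2; rewrite bE in r2'.
have split : coprime_to S = coprime_to (P :: S) `|` [set p * x | x in coprime_to S].
  apply/seteqP; split => [x [Ox xS]|x].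
    have [Px|Px] := pselect (P x).
      right; move: Px; rewrite PE => -[y Oy yx]; exists y => //; split => // Q QS Qy.
      by apply: (xS Q QS); rewrite -yx; apply: idealMl => //; exact: prime_is_ideal (prS' Q QS).
    by left; split => // Q; rewrite in_cons => /orP[/eqP ->//|/xS].
  move=> [[Ox xS]|[y [Oy yS] <-]]; split => //.
  - by move=> Q QS; apply: xS; rewrite in_cons QS orbT.
  - exact: OKM.
  - by move=> Q QS /(primeM (prS' _ QS) Op Oy)[/(Qp _ QS)|/(yS _ QS)].
have r3 : reps (PI a) (coprime_to S) (s1 ++ map ( *%R p) s2).
  rewrite split; apply: reps_cat => // x _ [Ox xS] [y [Oy _] <-] [z Oz zE].
  apply: (xS P); rewrite ?mem_head//.
  have -> : x = a * z + p * y by rewrite zE subrK.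
  apply: idealD => //.
    by apply: idealMr => //; apply: aS; rewrite mem_head.
  by apply: idealMr => //; rewrite PE; exact: PI_id.
have := IH a uS prS' Oa a0 (fun Q QS => aS Q (@mem_behead _ (P :: S) Q QS)).
rewrite (ncosets_reps hI r3) size_cat size_map natrD -(ncosets_reps (principal_is_ideal Ob) r2).
rewrite (IH b)// -(ncosets_reps hI r1) big_cons => h.
have N0 : qnorm p != 0 by rewrite qnorm_eq0.
apply: (addIr (qnorm b * \prod_(P <- S) (1 - (ideal_norm P)%:R^-1))).
by rewrite h -Np -bE qnormM; field.
Qed.

(** An element x is invertible modulo a unless some prime contains both, because
    aO + xO is contained in a prime if it is not O.  The list S may be larger than
    the set of primes containing a, so that one list serves for many a. *)
Lemma elt_phiE S a : uniq S -> (forall P, P \in S -> nonzero_prime_ideal P) ->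
  O a -> a != 0 -> (forall P, nonzero_prime_ideal P -> P a -> P \in S) ->
  (elt_phi a)%:R = qnorm a * \prod_(P <- S | `[< P a >]) (1 - (ideal_norm P)%:R^-1).
Proof.
move=> uS prS Oa a0 aS; rewrite -big_filter -ncosets_coprime ?filter_uniq//; last 2 first.
  by move=> P; rewrite mem_filter => /andP[_ /prS].
  by move=> P; rewrite mem_filter => /andP[/asboolP].
rewrite /elt_phi /ideal_phi /iquotient_units /ncosets; congr (ncard _)%:R.
suff -> : [set x | O x /\ exists2 y, O y & PI a (x * y - 1)] =
   coprime_to [seq P <- S | `[< P a >] ] by [].
apply/seteqP; split=> [x [Ox [y Oy axy]]|x [Ox xS]]; split=> //.
  move=> P; rewrite mem_filter => /andP[/asboolP Pa /prS pP] Px.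
  have hPi := prime_is_ideal pP; case: (pP) => _ + _; apply.
  apply: (ideal_1 hPi).
  have -> : 1 = x * y - (x * y - 1) by ring.
  by apply: idealB => //; [exact: idealMr|exact: (PI_sub hPi Pa)].
pose J := [set z | exists u v, [/\ O u, O v & z = a * u + x * v]].
have hJ : is_ideal J by exact: ideal_pair.
have Ja : J a by exists 1, 0; split; [exact: OK1|exact: OK0|ring].
have Jx : J x by exists 0, 1; split; [exact: OK0|exact: OK1|ring].
have [J1|J1] := pselect (J = O).
  have [u [v [Ou Ov uv]]] : J 1 by rewrite J1; exact: OK1.
  exists v => //; exists (- u); first exact: OKN.
  by rewrite uv; ring.
have nJ : nonzero_ideal J.
  by split=> // J0; move: Ja; rewrite J0 => /= h; rewrite h eqxx in a0.
have [P pP JP] := exists_prime_sup nJ J1.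
exfalso; apply: (xS P); last exact: JP.
by rewrite mem_filter; apply/andP; split; [apply/asboolP; exact: JP|apply: aS => //; exact: JP].
Qed.

End Index.

(** * Area of a circular sector by horizontal slices *)

Section Circle.
Import numFieldNormedType.Exports.
Variable R : realType.
Implicit Types (s t x r h : R).

(** The primitive of the square of cos that vanishes at 0.  The area between the
    vertical axis and the circle of radius r, from height 0 to height r sin t,
    is r^2 times [cos2_prim t]. *)
Definition cos2_prim s : R := (s + sin s * cos s) / 2.

#[local] Instance is_derive_cos2_prim x : is_derive x 1 cos2_prim (cos x ^+ 2).
Proof.
have -> : cos2_prim = (2^-1 : R) \*: (id \+ sin \* cos).
  by apply/funext => y; rewrite /cos2_prim /= mulrC.
apply: is_derive_eq.
transitivity ((2^-1 : R) * (1 + (sin x * - sin x + cos x * cos x))) => //.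
by have := cos2Dsin2 x; lra.
Qed.

Lemma cos_homo s t : 0 <= s -> s <= t -> t <= pi -> cos t <= cos s.
Proof.
move=> s0 st tp; have [->//|ne] := eqVneq s t.
have lt : s < t by rewrite lt_def eq_sym ne.
by rewrite ltW// ltr_cos// in_itv/=; apply/andP; split; lra.
Qed.

Lemma nondecreasing_of_deriv (f df : R -> R) (a b : R) : a <= b ->
  (forall x, is_derive x 1 f (df x)) ->
  (forall x, a <= x <= b -> 0 <= df x) -> f a <= f b.
Proof.
move=> ab fdf df0.
have cf : {within `[a, b], continuous f}.
  apply: continuous_subspaceT => x; apply: differentiable_continuous.
  by apply/derivable1_diffP; have := fdf x; case.
have [c] := MVT_segment ab (fun x _ => fdf x) cf.
rewrite in_itv /= => /df0 c0 E.
by rewrite -subr_ge0 E mulr_ge0// subr_ge0.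
Qed.

(** On [s, t] the derivative of [cos2_prim] lies between cos t * cos and
    cos s * cos. *)
Lemma cos2_prim_bounds s t : 0 <= s -> s <= t -> t <= pi / 2 ->
  cos t * (sin t - sin s) <= cos2_prim t - cos2_prim s <= cos s * (sin t - sin s).
Proof.
move=> s0 st tp; have pi0 := @pi_gt0 R.
have cosge x : s <= x <= t -> [/\ cos x <= cos s, cos t <= cos x & 0 <= cos x].
  move=> /andP[sx xt]; split.
  - by apply: cos_homo => //; lra.
  - by apply: cos_homo => //; lra.
  - by apply: cos_ge0_pihalf; apply/andP; split; lra.
apply/andP; split.
- have := @nondecreasing_of_deriv (cos2_prim \- cos t \*: sin)
    (fun x => cos x ^+ 2 - cos t * cos x) s t st.
  rewrite /= /GRing.scale /= => H; suff : cos2_prim s - cos t * sin s <= cos2_prim t - cos t * sin t by lra.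
  apply: H => x; last by move=> /cosge[? ? ?]; nra.
- have := @nondecreasing_of_deriv (cos s \*: sin \- cos2_prim)
    (fun x => cos s * cos x - cos x ^+ 2) s t st.
  rewrite /= /GRing.scale /= => H; suff : cos s * sin s - cos2_prim s <= cos s * sin t - cos2_prim t by lra.
  apply: H => x; last by move=> /cosge[? ? ?]; nra.
Qed.

Lemma sin_lt s t : 0 <= s -> s < t -> t <= pi / 2 -> sin s < sin t.
Proof.
move=> s0 st tp; have pi0 := @pi_gt0 R.
by rewrite ltr_sin// in_itv/=; apply/andP; split; lra.
Qed.

Lemma sin_homo s t : 0 <= s -> s <= t -> t <= pi / 2 -> sin s <= sin t.
Proof.
by move=> s0; rewrite le_eqVlt => /predU1P[->//|lt tp]; exact/ltW/sin_lt.
Qed.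

Lemma asin0 : asin 0 = 0 :> R.
Proof.
have pi0 := @pi_gt0 R.
by rewrite -{1}(@sin0 R) sinK// in_itv/=; apply/andP; split; lra.
Qed.

Lemma cos2_prim0 : cos2_prim 0 = 0. Proof. by rewrite /cos2_prim sin0 mul0r addr0 mul0r. Qed.

Section Rows.
Variables (r h t : R) (J : nat).
Hypotheses (r0 : 0 < r) (h0 : 0 < h) (t0 : 0 <= t) (tp : t <= pi / 2).
Hypotheses (Jle : J%:R * h <= r * sin t) (Jgt : r * sin t < J.+1%:R * h).

Let rad (j : nat) : R := Num.sqrt (r ^+ 2 - (j%:R * h) ^+ 2).
Let ang (j : nat) : R := asin (j%:R * h / r).

Lemma sint_ge0 : 0 <= sin t.
Proof. by have pi0 := @pi_gt0 R; have [t0' tp'] := (t0, tp); apply: sin_ge0_pi; apply/andP; split; lra. Qed.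
Lemma cost_ge0 : 0 <= cos t.
Proof. by have pi0 := @pi_gt0 R; have [t0' tp'] := (t0, tp); apply: cos_ge0_pihalf; apply/andP; split; lra. Qed.

Let jh j : (j <= J)%N -> 0 <= j%:R * h / r <= sin t.
Proof.
move=> jJ; apply/andP; split; first by rewrite divr_ge0 ?mulr_ge0 ?ler0n// ltW.
rewrite ler_pdivrMr// [sin t * r]mulrC (le_trans _ Jle)// ler_pM2r// ler_nat//.
Qed.

Let angP j : (j <= J)%N ->
  [/\ 0 <= ang j, ang j <= t, r * sin (ang j) = j%:R * h & r * cos (ang j) = rad j].
Proof.
move=> /jh /andP[j0 jt]; have s1 := sin_le1 t; have pi0 := @pi_gt0 R.
have j1 : -1 <= j%:R * h / r <= 1 by apply/andP; split; lra.
have sE : sin (ang j) = j%:R * h / r by rewrite asinK.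
have ap : ang j <= pi / 2 by exact: asin_lepi2.
have an : - (pi / 2) <= ang j by exact: asin_geNpi2.
split.
- rewrite leNgt; apply/negP => a0; have : 0 < sin (- ang j).
    by apply: sin_gt0_pi; apply/andP; split; lra.
  by rewrite sinN sE; lra.
- rewrite leNgt; apply/negP => a0.
  have : sin t < sin (ang j) by apply: sin_lt.
  by rewrite sE; lra.
- by rewrite sE mulrC divfK ?gt_eqF.
- rewrite /ang cos_asin//.
  rewrite -{1}(@ger0_norm _ r) ?ltW// -sqrtr_sqr -sqrtrM ?sqr_ge0//.
  by congr Num.sqrt; field; rewrite gt_eqF.
Qed.

Let sum_le n : (n <= J)%N -> \sum_(1 <= j < n.+1) rad j * h <= r ^+ 2 * cos2_prim (ang n).
Proof.
have [t0' tp'] := (t0, tp); elim: n => [_|n IH nJ]; first by rewrite big_geq// /ang mul0r mul0r asin0 cos2_prim0 mulr0.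
rewrite big_nat_recr//= (le_trans (lerD (IH (ltnW nJ)) (lexx _)))//.
have [a0 at1 sa ca] := angP nJ; have [b0 bt sb cb] := angP (ltnW nJ).
have ab : ang n <= ang n.+1.
  rewrite leNgt; apply/negP => lt.
  have : sin (ang n.+1) <= sin (ang n) by apply: sin_homo => //; lra.
  rewrite -(ler_pM2l r0) sa sb ler_pM2r// ler_nat ltnn//.
have /andP[+ _] := cos2_prim_bounds b0 ab (le_trans at1 tp).
rewrite -(ler_pM2l (exprn_gt0 2 r0)) !mulrBr -ca => H.
have E : r * cos (ang n.+1) * h = r ^+ 2 * (cos (ang n.+1) * sin (ang n.+1)) - r ^+ 2 * (cos (ang n.+1) * sin (ang n)).
  have -> : h = r * sin (ang n.+1) - r * sin (ang n) by rewrite sa sb -natr1; ring.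
  ring.
by rewrite E; lra.
Qed.

Let sum_ge n : (n <= J)%N -> r ^+ 2 * cos2_prim (ang n) <= \sum_(0 <= j < n) rad j * h.
Proof.
have [t0' tp'] := (t0, tp); elim: n => [_|n IH nJ]; first by rewrite big_geq// /ang mul0r mul0r asin0 cos2_prim0 mulr0.
rewrite big_nat_recr//=; apply: le_trans (lerD (IH (ltnW nJ)) (lexx _)).
have [a0 at1 sa ca] := angP nJ; have [b0 bt sb cb] := angP (ltnW nJ).
have ab : ang n <= ang n.+1.
  rewrite leNgt; apply/negP => lt.
  have : sin (ang n.+1) <= sin (ang n) by apply: sin_homo => //; lra.
  rewrite -(ler_pM2l r0) sa sb ler_pM2r// ler_nat ltnn//.
have /andP[_ +] := cos2_prim_bounds b0 ab (le_trans at1 tp).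
rewrite -(ler_pM2l (exprn_gt0 2 r0)) !mulrBr -cb => H.
have E : r * cos (ang n) * h = r ^+ 2 * (cos (ang n) * sin (ang n.+1)) - r ^+ 2 * (cos (ang n) * sin (ang n)).
  have -> : h = r * sin (ang n.+1) - r * sin (ang n) by rewrite sa sb -natr1; ring.
  ring.
by rewrite E; lra.
Qed.

(** A Riemann sum of step h for the area under the circle: [cos2_prim_bounds]
    between consecutive angles [ang j] compares each slice with a rectangle.  As
    the radius decreases with the height, the total error is at most one slice. *)
Lemma sum_rad : `|h * \sum_(1 <= j < J.+1) rad j - r ^+ 2 * cos2_prim t| <= h * r.
Proof.
have [a0 at1 sa ca] := angP (leqnn J).
have /andP[L U] := cos2_prim_bounds a0 at1 tp.
have rJ : rad J <= r.
  rewrite -ca -[leRHS]mulr1 ler_pM2l//; exact: cos_le1.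
have rJ0 : 0 <= rad J by exact: sqrtr_ge0.
have l1 := sum_le (leqnn J); have l2 := sum_ge (leqnn J).
have st : sin (ang J) <= sin t by apply: sin_homo.
have F1 : cos2_prim (ang J) <= cos2_prim t.
  apply: le_trans (_ : cos2_prim (ang J) + cos t * (sin t - sin (ang J)) <= _); last lra.
  by rewrite lerDl mulr_ge0 ?cost_ge0 ?subr_ge0.
have F2 : r ^+ 2 * cos2_prim t - r ^+ 2 * cos2_prim (ang J) <= rad J * h.
  have : r ^+ 2 * (cos2_prim t - cos2_prim (ang J)) <= r ^+ 2 * (cos (ang J) * (sin t - sin (ang J))).
    by rewrite ler_pM2l ?exprn_gt0.
  have -> : r ^+ 2 * (cos (ang J) * (sin t - sin (ang J))) =
     (r * cos (ang J)) * (r * sin t - r * sin (ang J)) by ring.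
  rewrite ca sa mulrBr => H; apply: (le_trans H).
  by apply: ler_wpM2l => //; move: Jgt; rewrite -natr1 mulrDl mul1r; lra.
have F3 : r ^+ 2 * cos2_prim (ang J) <= r ^+ 2 * cos2_prim t by rewrite ler_pM2l ?exprn_gt0.
have S0 : \sum_(0 <= j < J) rad j * h + rad J * h = r * h + \sum_(1 <= j < J.+1) rad j * h.
  rewrite -(@big_nat_recr _ _ _ _ _ (fun j => rad j * h))//= big_nat_recl// big_add1 /=.
  by rewrite /rad mul0r expr0n subr0 sqrtr_sqr gtr0_norm.
rewrite mulr_sumr; under eq_bigr do rewrite mulrC.
by rewrite ler_norml; apply/andP; split; lra.
Qed.

(** The same for the triangle cut off by the ray of angle t, where the sum is an
    arithmetic progression.  If sin t = 0 then J = 0 and the sum is empty. *)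
Lemma sum_line : `|h * \sum_(1 <= j < J.+1) (j%:R * h * cos t / sin t) -
   r ^+ 2 * (sin t * cos t / 2)| <= h * r.
Proof.
have s0 := sint_ge0; have c0 := cost_ge0; have c1 := cos_le1 t; have s1 := sin_le1 t.
have E n : \sum_(1 <= j < n.+1) (j%:R * h * cos t / sin t) =
  (n%:R * n.+1%:R / 2) * h * (cos t / sin t).
  elim: n => [|n IH]; first by rewrite big_geq// !mul0r.
  by rewrite big_nat_recr//= IH -!natr1; move: (sin t)^-1 => q; field.
rewrite E; have [J0|J0] := posnP J.
  move: Jgt; rewrite J0 mul1r !mul0r mulr0 sub0r normrN => Jg.
  rewrite ger0_norm; last by rewrite mulr_ge0 ?sqr_ge0// divr_ge0// mulr_ge0.
  have : r * sin t * cos t <= h * 1.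
    by apply: ler_pM => //; [rewrite mulr_ge0 // ltW|exact: ltW].
  move=> /(ler_wpM2l (ltW r0)).
  have : 0 <= r * (r * sin t * cos t) by rewrite !mulr_ge0 // ltW.
  lra.
have sp : 0 < sin t.
  rewrite lt_def s0 andbT; apply/eqP => sz.
  move: Jle; rewrite sz mulr0 leNgt mulr_gt0// ltr0n//.
set e := r * sin t - J%:R * h.
have e0 : 0 <= e by rewrite subr_ge0.
have e1 : e <= h by move: Jgt; rewrite /e -natr1; lra.
have rE : r = (J%:R * h + e) / sin t by rewrite /e; field; rewrite gt_eqF.
have -> : h * (J%:R * J.+1%:R / 2 * h * (cos t / sin t)) - r ^+ 2 * (sin t * cos t / 2)
  = (cos t / sin t / 2) * (J%:R * h * h - J%:R * h * e *+ 2 - e ^+ 2).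
  by rewrite {1}rE -natr1; field; rewrite gt_eqF.
have J1 : 1 <= J%:R :> R by rewrite ler1n.
have cs : 0 <= cos t / sin t / 2 by rewrite !divr_ge0.
rewrite normrM ger0_norm//.
have B : `|J%:R * h * h - J%:R * h * e *+ 2 - e ^+ 2| <= 2 * h * (J%:R * h).
  have hJ : h <= J%:R * h by rewrite ler_peMl// ltW.
  have q0 : 0 <= J%:R * h by rewrite mulr_ge0// ltW.
  have := mulr_ge0 q0 e0; have := ler_wpM2l q0 e1.
  have := mulr_ge0 e0 e0; have := ler_pM e0 e0 e1 e1.
  have := ler_wpM2r (ltW h0) hJ.
  by rewrite ler_norml => *; apply/andP; split; lra.
apply: (le_trans (ler_wpM2l cs B)).
apply: (le_trans (ler_wpM2l cs (ler_wpM2l _ Jle))); first by rewrite mulr_ge0// ltW.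
have -> : cos t / sin t / 2 * (2 * h * (r * sin t)) = h * r * cos t.
  by field; rewrite gt_eqF.
by rewrite -[leRHS]mulr1 ler_wpM2l// mulr_ge0// ltW.
Qed.

(** The sector of radius r and of angles 0 to t meets the line of height y in the
    segment from y cos t / sin t to sqrt(r^2 - y^2), so its area is the area under
    the circle minus that of the triangle. *)
Lemma sum_rows : `|\sum_(1 <= j < J.+1) (rad j - j%:R * h * cos t / sin t) -
   t * r ^+ 2 / (2 * h)| <= 2 * r.
Proof.
rewrite -(ler_pM2l h0) -{1}(gtr0_norm h0) -normrM.
rewrite big_split /= sumrN.
have := sum_rad; have := sum_line.
set A := \sum_(_ <= _ < _) _; set B := \sum_(_ <= _ < _) _ => H1 H2.
have -> : h * (B - A - t * r ^+ 2 / (2 * h)) =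
  (h * B - r ^+ 2 * cos2_prim t) - (h * A - r ^+ 2 * (sin t * cos t / 2)).
  by rewrite /cos2_prim; field; rewrite gt_eqF.
by apply: (le_trans (ler_normB _ _)); lra.
Qed.
End Rows.

(** The end point l may be counted or not: this gives one estimate for sectors
    with or without their boundary ray. *)
Lemma count_int (s : seq int) (l m : R) : uniq s -> l <= m ->
  (forall i : int, l < i%:~R <= m -> i \in s) ->
  (forall i : int, i \in s -> l <= i%:~R <= m) ->
  `|(size s)%:R - (m - l)| <= 1.
Proof.
move=> us lm lo hi.
have fm1 := floor_le m; have fm2 := floorD1_gt m.
have fl1 := floor_le l; have fl2 := floorD1_gt l.
have cl1 := ceil_ge l; have cl2 : (Num.ceil l)%:~R < l + 1 by have := ceilB1_lt l; rewrite rmorphB /=; lra.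
rewrite ler_norml; apply/andP; split.
- have lf : Num.floor l <= Num.floor m by exact: le_floor.
  pose T := [seq Num.floor l + 1 + k%:Z | k <- iota 0 `|Num.floor m - Num.floor l|].
  have : (size T <= size s)%N.
    apply: uniq_leq_size.
      by rewrite map_inj_uniq ?iota_uniq// => x y /addrI [].
    move=> i /mapP[k]; rewrite mem_iota add0n => /andP[_ kl] ->; apply: lo.
    have kl' : k%:Z < Num.floor m - Num.floor l by lia.
    have : (Num.floor l + 1 + k%:Z <= Num.floor m) by lia.
    rewrite -(ler_int R) => H; apply/andP; split; last lra.
    by rewrite rmorphD /= (lt_le_trans fl2)// lerDl ler0z.
  rewrite size_map size_iota -(ler_nat R) natr_absz ger0_norm ?subr_ge0// rmorphB /=.
  by move: fm2; rewrite rmorphD /=; lra.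
- have lf : Num.ceil l <= Num.floor m + 1.
    suff : Num.ceil l < Num.floor m + 2 by lia.
    by rewrite -(ltr_int R) rmorphD /=; move: fm2; rewrite rmorphD /=; lra.
  pose T := [seq Num.ceil l + k%:Z | k <- iota 0 (absz (Num.floor m + 1 - Num.ceil l)%R)].
  have : (size s <= size T)%N.
    apply: uniq_leq_size => // i /hi /andP[li im].
    have ci : Num.ceil l <= i by rewrite ceil_le_int.
    have fi : i <= Num.floor m by rewrite floor_ge_int.
    apply/mapP; exists (absz (i - Num.ceil l)); last by lia.
    by rewrite mem_iota add0n /=; lia.
  rewrite size_map size_iota -(ler_nat R) natr_absz ger0_norm ?subr_ge0// rmorphB rmorphD /=.
  lra.
Qed.

End Circle.

(** * Lattice points in sectors of the first quadrant *)

Section NCard.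
Variables T U : choiceType.

Lemma finite_list (A : set T) : finite_set A ->
  exists s : seq T, [/\ uniq s, (forall x, A x <-> x \in s) & ncard A = size s].
Proof.
move=> fA; exists (fset_set A); split => //.
by move=> x; rewrite in_fset_set// inE.
Qed.

Lemma ncardU (A B : set T) : finite_set A -> finite_set B ->
  (forall x, A x -> B x -> False) -> ncard (A `|` B) = (ncard A + ncard B)%N.
Proof.
move=> /finite_list[s [us sE ->]] /finite_list[t [ut tE ->]] AB.
rewrite -size_cat; apply: ncard_seq => [|x].
  rewrite cat_uniq us ut andbT; apply/hasPn => x /tE Bx; apply/negP => /sE Ax.
  exact: AB Ax Bx.
rewrite mem_cat; split=> [[/sE ->//|/tE ->]|/orP[/sE|/tE]]; rewrite ?orbT//; by [left|right].
Qed.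

Lemma ncard_image (A : set T) (f : T -> U) : finite_set A ->
  (forall x y, A x -> A y -> f x = f y -> x = y) -> ncard (f @` A) = ncard A.
Proof.
move=> /finite_list[s [us sE ->]] fI; rewrite -(size_map f).
apply: ncard_seq => [|y].
  by rewrite map_inj_in_uniq// => x y /sE Ax /sE Ay; exact: fI.
split=> [[x /sE xs <-]|/mapP[x /sE Ax ->]]; first exact: map_f.
by exists x.
Qed.

Lemma ncard_le (A B : set T) : finite_set B -> A `<=` B -> (ncard A <= ncard B)%N.
Proof.
move=> fB AB; have := sub_finite_set AB fB.
move: fB => /finite_list[s [us sE ->]] /finite_list[t [ut tE ->]].
by apply: uniq_leq_size => // x /tE /AB /sE.
Qed.

Lemma ncard0 (A : set T) : (forall x, ~ A x) -> ncard A = 0%N.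
Proof. by move=> h; apply: (@ncard_seq _ _ [::]) => // x; split => // /h. Qed.

End NCard.

Lemma ncard_sum_fibers (T : choiceType) (A : set T) (P : nat -> set T) n :
  finite_set A -> (forall i j x, P i x -> P j x -> i = j) ->
  ncard [set x | A x /\ exists2 j, (j < n)%N & P j x] =
  (\sum_(0 <= j < n) ncard (A `&` P j))%N.
Proof.
move=> fA Pd; elim: n => [|n IH].
  by rewrite big_geq// ncard0// => x [_ [j]].
rewrite big_nat_recr//= -IH -ncardU; last first.
- by move=> x [_ [j jn Pj]] [_ Pn]; move: jn; rewrite (Pd _ _ _ Pj Pn) ltnn.
- exact: finite_setIl.
- by apply: sub_finite_set fA => x [].
congr ncard; apply/seteqP; split => x.
  move=> [Ax [j]]; rewrite ltnS leq_eqVlt => /predU1P[->|jn] Pj; first by right.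
  by left; split => //; exists j.
move=> [[Ax [j jn Pj]]|[Ax Pn]]; split => //; first by exists j => //; exact: ltnW.
by exists n.
Qed.

Lemma int_shift (k : int) (M : nat) : `|k| < M.+1%:Z ->
  (absz (k + M.+1%:Z)%R) \in iota 0 (M + M).+3 /\
  (absz (k + M.+1%:Z)%R)%:Z - M.+1%:Z = k.
Proof. by rewrite mem_iota; lia. Qed.

Section LatticeCount.
Variables (R : realType) (K : fieldExtType rat).
Variable iota : {rmorphism K -> complex R}.
Local Notation re a := (complex.Re (iota a)).
Local Notation im a := (complex.Im (iota a)).
Local Notation O := (@ring_of_integers K).
Local Notation qnorm := (qnorm iota).
Local Notation qconj := (@qconj K).
Hypothesis hIQ : imaginary_quadratic iota.
Variable w : K.
Hypotheses (Ow : O w) (w0 : 0 < im w).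
Hypothesis Obas : forall a, O a -> exists i j : int, a = i%:~R + j%:~R * w.
Local Notation h := (im w).

Let pt (i j : int) : K := i%:~R + j%:~R * w.
Let rept i j : re (pt i j) = i%:~R + j%:~R * re w.
Proof. by rewrite reD reM !re_int im_int; ring. Qed.
Let impt i j : im (pt i j) = j%:~R * h.
Proof. by rewrite imD imM !im_int re_int; ring. Qed.
Let Opt i j : O (pt i j).
Proof. by apply: OKD; [exact: OK_int|apply: OKM => //; exact: OK_int]. Qed.

Definition int_disc r : set K := [set a | O a /\ qnorm a <= r].

Lemma int_disc_finite r : finite_set (int_disc r).
Proof.
pose M := Num.truncn (`|r| + 1 + (`|r| + 1) / h * `|re w| + (`|r| + 1) / h).
pose L := [seq pt (i%:Z - M.+1%:Z) (j%:Z - M.+1%:Z) | i <- seq.iota 0 (M + M).+3, j <- seq.iota 0 (M + M).+3].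
apply: (@sub_finite_set _ _ [set` L]); last exact: finite_seq.
move=> a [/Obas[i [j ->]]]; rewrite -/(pt i j) /qnorm rept impt => ar.
have h0 := w0.
have r1 : r <= (`|r| + 1) ^+ 2.
  have := ler_norm r; have := normr_ge0 r; move: `|r| => s s0 rs; nra.
have sq (x y : R) : 0 <= y -> x ^+ 2 <= y ^+ 2 -> `|x| <= y.
  by move=> y0 xy; rewrite -ler_sqr ?nnegrE// real_normK ?num_real.
have rp : 0 <= `|r| + 1 by rewrite addr_ge0.
have B1 : `|j%:~R * h| <= `|r| + 1.
  apply: sq => //; have := sqr_ge0 (i%:~R + j%:~R * re w); lra.
have B2 : `|i%:~R + j%:~R * re w| <= `|r| + 1.
  apply: sq => //; have := sqr_ge0 (j%:~R * h); lra.
have Bj : `|j%:~R| <= (`|r| + 1) / h.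
  by rewrite ler_pdivlMr// -{1}(gtr0_norm h0) -normrM.
have Bi : `|i%:~R| <= `|r| + 1 + (`|r| + 1) / h * `|re w|.
  have -> : i%:~R = (i%:~R + j%:~R * re w) - j%:~R * re w by ring.
  apply: le_trans (ler_normB _ _) _; rewrite lerD// normrM ler_wpM2r//.
have q0 : 0 <= (`|r| + 1) / h by rewrite divr_ge0// ltW.
have MM : `|r| + 1 + (`|r| + 1) / h * `|re w| + (`|r| + 1) / h < M.+1%:R by exact: truncnS_gt.
have q1 : 0 <= `|r| + 1 + (`|r| + 1) / h * `|re w| by rewrite addr_ge0// mulr_ge0.
have in_ (k : int) : `|k%:~R| < M.+1%:R :> R -> (absz (k + M.+1%:Z)%R) \in seq.iota 0 (M + M).+3 /\ (absz (k + M.+1%:Z)%R)%:Z - M.+1%:Z = k.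
  by rewrite -intr_norm (ltr_int R _ M.+1%:Z); exact: int_shift.
have [|i1 i2] := in_ i; first by apply: le_lt_trans Bi (le_lt_trans _ MM); rewrite lerDl.
have [|j1 j2] := in_ j; first by apply: le_lt_trans Bj (le_lt_trans _ MM); rewrite lerDr.
apply/allpairsP; exists (absz (i + M.+1%:Z)%R, absz (j + M.+1%:Z)%R).
by split => //=; rewrite i2 j2.
Qed.

Let rowset (j : nat) : set K := [set a | im a = j%:R * h].

Let row_count (X : set K) (j : nat) (l m : R) : finite_set X -> X `<=` O -> l <= m ->
  (forall a, O a -> im a = j%:R * h -> l < re a <= m -> X a) ->
  (forall a, X a -> im a = j%:R * h -> l <= re a <= m) ->
  `|(ncard (X `&` rowset j))%:R - (m - l)| <= 1.
Proof.
move=> fX XO lm lo hi; have h0 := w0.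
have [s [us sE ->]] := finite_list (finite_setIl (rowset j) fX).
have sP a : a \in s -> exists i : int, a = pt i j%:Z.
  move=> /sE[/XO /Obas[i [k ->]]]; rewrite /rowset /= -/(pt i k) impt => H.
  exists i; congr (pt _ _); apply: (@intr_inj R); apply: (mulIf (lt0r_neq0 h0)).
  by rewrite H.
pose c := j%:R * re w; pose f a := Num.floor (re a - c).
have fpt i : f (pt i j%:Z) = i by rewrite /f rept addrK intrKfloor.
have fI : {in s &, injective f}.
  by move=> a b /sP[i ->] /sP[k ->]; rewrite !fpt => ->.
have -> : m - l = (m - c) - (l - c) by ring.
rewrite -(size_map f); apply: count_int.
- by rewrite map_inj_in_uniq.
- by rewrite lerD2r.
- move=> i /andP[li im_]; rewrite -(fpt i); apply/map_f/sE; split; last by rewrite /rowset /= impt.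
  apply: lo; [exact: Opt|exact: impt|].
  by rewrite rept; apply/andP; split; rewrite -/c /c in li im_ *; lra.
- move=> _ /mapP[a /[dup] /sP[i ->] /sE[Xa ra] ->]; rewrite fpt.
  have := hi _ Xa ra; rewrite rept -/c => /andP[L1 L2]; apply/andP; split; lra.
Qed.

(** Nothing is said about which points of the two boundary rays belong to X, so
    that the statement applies both to a sector and to a mirror image.  Each of
    the rows of positive height contains as many points as its length, up to 1
    (there are O(r) of them), and the real axis contains O(r) points. *)
Lemma card_first_quadrant_sector (X : set K) (t r : R) : 0 <= t -> t <= pi / 2 -> 1 <= r ->
  (forall a, O a -> 0 < im a -> im a * cos t < re a * sin t -> qnorm a <= r ^+ 2 -> X a) ->
  (forall a, X a -> [/\ O a, 0 <= im a, 0 <= re a, im a * cos t <= re a * sin t & qnorm a <= r ^+ 2]) ->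
  `|(ncard X)%:R - t * r ^+ 2 / (2 * h)| <= (5 + h^-1) * r.
Proof.
move=> t0 tp r1 lo hi; have h0 := w0; have r0 : 0 < r by lra.
have fX : finite_set X by apply: sub_finite_set (int_disc_finite (r ^+ 2)) => a /hi[].
have XO : X `<=` O by move=> a /hi[].
have st0 : 0 <= sin t by exact: sint_ge0.
have ct0 : 0 <= cos t by exact: cost_ge0.
have cs1 := cos2Dsin2 t.
pose J := Num.truncn (r * sin t / h).
have rsh : 0 <= r * sin t / h by rewrite divr_ge0 ?mulr_ge0// ltW.
have Jle : J%:R * h <= r * sin t by rewrite -ler_pdivlMr// truncn_le.
have Jgt : r * sin t < J.+1%:R * h by rewrite -ltr_pdivrMr// truncnS_gt.
have imr a : X a -> im a <= r * sin t.
  move=> /hi[Oa i0 r0' H N]; have : (im a) ^+ 2 <= (r * sin t) ^+ 2.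
    have e : im a ^+ 2 = (im a * cos t) ^+ 2 + (im a * sin t) ^+ 2.
      by rewrite !exprMn -mulrDr cs1 mulr1.
    have : (im a * cos t) ^+ 2 <= (re a * sin t) ^+ 2.
      by rewrite ler_sqr ?nnegrE ?mulr_ge0.
    have : (re a ^+ 2 + im a ^+ 2) * sin t ^+ 2 <= r ^+ 2 * sin t ^+ 2.
      by rewrite ler_wpM2r ?sqr_ge0.
    by move=> N2 N1; rewrite !exprMn in e N1 *; lra.
  by rewrite ler_sqr ?nnegrE ?mulr_ge0// ltW.
have rowP a : X a -> exists2 j, (j < J.+1)%N & rowset j a.
  move=> Xa; have [Oa i0 _ _ _] := hi _ Xa.
  have [i [k kE]] := Obas Oa; rewrite -/(pt i k) in kE.
  have k0 : 0 <= k.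
    by move: i0; rewrite kE impt pmulr_lge0// ler0z.
  exists `|k|%N; last by rewrite /rowset /= kE impt; case: (k) k0.
  have : im a < J.+1%:R * h by rewrite (le_lt_trans (imr _ Xa)).
  by rewrite kE impt ltr_pM2r// (ltr_int R k J.+1%:Z); move: k0; clear; lia.
have XE : X = [set a | X a /\ exists2 j, (j < J.+1)%N & rowset j a].
  by apply/seteqP; split => [a Xa|a []//]; split => //; exact: rowP.
have rowI i j a : rowset i a -> rowset j a -> i = j.
  rewrite /rowset /= => -> /(mulIf (lt0r_neq0 h0)) /eqP; rewrite eqr_nat => /eqP//.
rewrite {1}XE (ncard_sum_fibers _ fX rowI) big_nat_recl// natrD.
(* The real axis is a boundary ray, so only an upper bound is available there. *)
have R0 : (ncard (X `&` rowset 0))%:R <= r + 1.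
  have fR := finite_setIl (rowset 0) fX.
  pose Y := [set a | [/\ O a, im a = 0 & 0 <= re a <= r]].
  have YB : Y `<=` int_disc (r ^+ 2).
    move=> a [Oa a0 /andP[ra ra']]; split => //.
    by rewrite /qnorm a0 expr0n addr0 ler_sqr ?nnegrE// ltW.
  have fY := sub_finite_set YB (int_disc_finite _).
  apply: (@le_trans _ _ (ncard (Y `&` rowset 0))%:R).
    rewrite ler_nat; apply: ncard_le; first exact: finite_setIl.
    move=> a [/hi[Oa _ ra _ N]]; rewrite /rowset /= mul0r => a0.
    split; last by rewrite /rowset /= ?mul0r.
    split => //; rewrite ra /=; move: N; rewrite /qnorm a0 expr0n addr0 ler_sqr ?nnegrE// ltW//.
  have := @row_count Y 0 0 r fY (fun a (H : Y a) => let: And3 x _ _ := H in x) (ltW r0).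
  rewrite mul0r subr0 ler_norml => H.
  suff /andP[_ ?] : -1 <= (ncard (Y `&` rowset 0))%:R - r <= 1 by lra.
  apply: H => [a Oa a0 /andP[/ltW ra ra']|a []//].
  by split => //; rewrite ra.
pose rad (j : nat) : R := Num.sqrt (r ^+ 2 - (j%:R * h) ^+ 2).
have rows j : (j < J)%N ->
  `|(ncard (X `&` rowset j.+1))%:R - (rad j.+1 - j.+1%:R * h * cos t / sin t)| <= 1.
  move=> jJ; set v := j.+1%:R * h.
  have v0 : 0 < v by rewrite mulr_gt0.
  have vr : v <= r * sin t by rewrite (le_trans _ Jle)// ler_pM2r// ler_nat.
  have sp : 0 < sin t.
    rewrite lt_def st0 andbT; apply/eqP => sz; move: vr; rewrite sz mulr0 leNgt v0//.
  have v2 : v ^+ 2 <= (r * sin t) ^+ 2 by rewrite ler_sqr ?nnegrE ?mulr_ge0// ltW.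
  have st1 : sin t ^+ 2 <= 1 by have := sqr_ge0 (cos t); lra.
  have rd0 : 0 <= r ^+ 2 - v ^+ 2.
    have : r ^+ 2 * sin t ^+ 2 <= r ^+ 2 * 1 by rewrite ler_wpM2l ?sqr_ge0.
    by rewrite [(r * sin t) ^+ 2]exprMn in v2; lra.
  apply: row_count => //.
  - rewrite -ler_sqr ?nnegrE ?sqrtr_ge0//; last by rewrite divr_ge0 ?mulr_ge0// ltW.
    rewrite sqr_sqrtr// !exprMn exprVn ler_pdivrMr ?exprn_gt0// mulrBl.
    rewrite [(r * sin t) ^+ 2]exprMn in v2.
    have -> : j.+1%:R ^+ 2 * h ^+ 2 = v ^+ 2 by rewrite exprMn.
    have -> : cos t ^+ 2 = 1 - sin t ^+ 2 by lra.
    lra.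
  - move=> a Oa av /andP[la ra]; apply: lo => //; first by rewrite av.
      by rewrite -ltr_pdivrMr// av.
    rewrite /qnorm av -/v; have : re a ^+ 2 <= rad j.+1 ^+ 2.
      rewrite ler_sqr ?nnegrE ?sqrtr_ge0//.
      by apply: le_trans (ltW la); rewrite divr_ge0 ?mulr_ge0// ltW.
    by rewrite [rad j.+1 ^+ 2]sqr_sqrtr// -/v; lra.
  - move=> a /hi[Oa i0 ra H N] av; apply/andP; split.
      by rewrite ler_pdivrMr//; move: H; rewrite av.
    rewrite -ler_sqr ?nnegrE ?sqrtr_ge0// sqr_sqrtr//.
    by move: N; rewrite /qnorm av -/v; lra.
have := sum_rows r0 h0 t0 tp Jle Jgt; rewrite -/rad big_add1 /= => S.
rewrite natr_sum.
have D : `|\sum_(0 <= j < J) (ncard (X `&` rowset j.+1))%:R -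
   \sum_(0 <= j < J) (rad j.+1 - j.+1%:R * h * cos t / sin t)| <= J%:R :> R.
  rewrite -sumrB; apply: le_trans (ler_norm_sum _ _ _) _.
  apply: (@le_trans _ _ (\sum_(0 <= j < J) 1)); last by rewrite sumr_const_nat subn0.
  by apply: ler_sum_nat => j /andP[_ jJ]; exact: rows.
have JB : J%:R <= h^-1 * r.
  rewrite mulrC ler_pdivlMr//; apply: le_trans Jle _.
  by rewrite ger_pMr// sin_le1.
have R0' : 0 <= (ncard (X `&` rowset 0))%:R :> R by [].
move: D S; rewrite !ler_norml => /andP[? ?] /andP[? ?].
by apply/andP; split; lra.
Qed.

End LatticeCount.

(** * Lattice points in arbitrary sectors *)

Lemma fsbig_list (V : Type) (idx : V) (op : Monoid.com_law idx) (T : choiceType)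
    (A : set T) (s : seq T) (F : T -> V) : uniq s -> (forall x, A x <-> x \in s) ->
  \big[op/idx]_(a \in A) F a = \big[op/idx]_(a <- s) F a.
Proof.
move=> us As; rewrite [RHS]fsbig_seq//.
by have -> : A = [set` s] by apply/seteqP; split => a /As.
Qed.

Lemma sum_natr (F : numFieldType) (n : nat) :
  \sum_(0 <= j < n) j%:R = n%:R * (n%:R - 1) / 2 :> F.
Proof.
elim: n => [|n IH]; first by rewrite big_geq// !mul0r.
by rewrite big_nat_recr//= IH -natr1; field.
Qed.

Section Polar.
Variable R : realType.
Implicit Types (x y t d : R).

Lemma cos_add2pi t : cos (t + 2 * pi) = cos t :> R.
Proof. by rewrite mulr_natl cosD2pi. Qed.
Lemma sin_add2pi t : sin (t + 2 * pi) = sin t :> R.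
Proof. by rewrite mulr_natl sinD2pi. Qed.

Lemma polar_coordinates x y : 0 < x ^+ 2 + y ^+ 2 -> exists t,
  [/\ 0 < t <= 2 * pi, x = Num.sqrt (x ^+ 2 + y ^+ 2) * cos t &
      y = Num.sqrt (x ^+ 2 + y ^+ 2) * sin t].
Proof.
move=> xy; set p := Num.sqrt _; have pi0 := @pi_gt0 R.
have p0 : 0 < p by rewrite sqrtr_gt0.
have p2 : p ^+ 2 = x ^+ 2 + y ^+ 2 by rewrite sqr_sqrtr// ltW.
have cB : -1 <= x / p <= 1.
  rewrite -ler_norml normrM normfV (gtr0_norm p0) ler_pdivrMr// mul1r.
  by rewrite -ler_sqr ?nnegrE ?(ltW p0)// real_normK ?num_real// p2 lerDl sqr_ge0.
have s0 := acos_ge0 cB; have sp := acos_lepi cB.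
have cs : p * cos (acos (x / p)) = x by rewrite acosK// mulrC divfK// gt_eqF.
have sn : p * sin (acos (x / p)) = `|y|.
  rewrite sin_acos// -{1}(gtr0_norm p0) -sqrtr_sqr -sqrtrM ?sqr_ge0//.
  rewrite -sqrtr_sqr; congr Num.sqrt.
  have -> : y ^+ 2 = p ^+ 2 - x ^+ 2 by rewrite p2; ring.
  by field; rewrite gt_eqF.
have [y0|y0] := ltP 0 y.
  exists (acos (x / p)); rewrite cs sn gtr0_norm//; split=> //.
  apply/andP; split; last lra.
  rewrite lt_def s0 andbT; apply/eqP => z; move: sn; rewrite z sin0 mulr0 => /esym/eqP.
  by rewrite normr_eq0 gt_eqF.
exists (2 * pi - acos (x / p)); split.
- by apply/andP; split; lra.
- by rewrite addrC cos_add2pi cosN cs.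
- by rewrite addrC sin_add2pi sinN mulrN sn ler0_norm// opprK.
Qed.

Lemma cos_eq1 d : `|d| < 2 * pi -> cos d = 1 -> d = 0.
Proof.
move=> dp; have dE : d = (d / 2) *+ 2 by rewrite -mulr_natr divfK// pnatr_eq0.
rewrite {1}dE cos_mulr2n => c1.
have s2 : sin (d / 2) ^+ 2 = 0 by rewrite sin2cos2; move: c1; rewrite mulr2n; lra.
have /eqP s0 : sin (d / 2) == 0 by rewrite -sqrf_eq0 s2.
move: dp; rewrite ltr_norml => /andP[d1 d2].
have [d0|d0|//] := ltgtP d 0.
- have : 0 < sin (- (d / 2)) by apply: sin_gt0_pi; apply/andP; split; lra.
  by rewrite sinN s0 oppr0 ltxx.
- have : 0 < sin (d / 2) by apply: sin_gt0_pi; apply/andP; split; lra.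
  by rewrite s0 ltxx.
Qed.
End Polar.

Section SectorCount.
Variables (R : realType) (K : fieldExtType rat).
Variable iota : {rmorphism K -> complex R}.
Local Notation re a := (complex.Re (iota a)).
Local Notation im a := (complex.Im (iota a)).
Local Notation O := (@ring_of_integers K).
Local Notation qnorm := (qnorm iota).
Local Notation qconj := (@qconj K).
Local Notation int_disc := (int_disc iota).
Hypothesis hIQ : imaginary_quadratic iota.
Variable w : K.
Hypotheses (Ow : O w) (w0 : 0 < im w).
Hypothesis Obas : forall a, O a -> exists i j : int, a = i%:~R + j%:~R * w.
Local Notation h := (im w).

(** A relation rather than a function, so that no determination of the argument
    has to be chosen. *)
Definition has_arg (a : K) (t : R) : Prop :=
  re a = Num.sqrt (qnorm a) * cos t /\ im a = Num.sqrt (qnorm a) * sin t.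

Definition int_sector (al be r : R) : set K :=
  [set a | [/\ O a, a != 0, qnorm a <= r ^+ 2 & exists2 t, al < t <= be & has_arg a t]].

Lemma has_arg_ex a : a != 0 -> exists2 t, 0 < t <= 2 * pi & has_arg a t.
Proof. by move=> /(qnorm_gt0 iota) /polar_coordinates[t [? ? ?]]; exists t. Qed.

Lemma has_arg_uniq a t t' : a != 0 -> has_arg a t -> has_arg a t' -> `|t - t'| < 2 * pi -> t = t'.
Proof.
move=> a0 [r1 i1] [r2 i2] d; apply/eqP; rewrite -subr_eq0; apply/eqP.
apply: cos_eq1 => //; rewrite cosB.
have s0 : Num.sqrt (qnorm a) != 0 by rewrite gt_eqF// sqrtr_gt0 qnorm_gt0.
have -> : cos t' = cos t by apply: (mulfI s0); rewrite -r1 -r2.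
have -> : sin t' = sin t by apply: (mulfI s0); rewrite -i1 -i2.
by rewrite -!expr2 cos2Dsin2.
Qed.

Lemma has_arg_add2pi a t : has_arg a (t + 2 * pi) <-> has_arg a t.
Proof. by rewrite /has_arg cos_add2pi sin_add2pi. Qed.

Lemma has_arg_opp a t : has_arg a t -> has_arg (- a) (t + pi).
Proof.
by move=> [r1 i1]; rewrite /has_arg reN imN qnormN cosDpi sinDpi !mulrN -r1 -i1.
Qed.

(** The reflection in the imaginary axis, used to reach the second quadrant: a
    rotation by a right angle does not preserve the lattice O in general. *)
Definition mirror (a : K) := - qconj a.
Lemma mirrorK : involutive mirror.
Proof. by move=> a; rewrite /mirror (qconjN hIQ) opprK (qconjK hIQ). Qed.
Lemma re_mirror a : re (mirror a) = - re a. Proof. by rewrite reN (re_qconj hIQ). Qed.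
Lemma im_mirror a : im (mirror a) = im a. Proof. by rewrite imN im_qconj opprK. Qed.
Lemma qnorm_mirror a : qnorm (mirror a) = qnorm a. Proof. by rewrite qnormN (qnorm_qconj hIQ). Qed.
Lemma OK_mirror a : O a -> O (mirror a). Proof. by move=> Oa; apply: OKN; exact: OK_qconj hIQ _ Oa. Qed.
Lemma mirror_neq0 a : (mirror a != 0) = (a != 0).
Proof. by rewrite -!(qnorm_eq0 iota) qnorm_mirror. Qed.

Lemma has_arg_mirror a t : has_arg a t -> has_arg (mirror a) (pi - t).
Proof.
move=> [r1 i1]; rewrite /has_arg re_mirror im_mirror qnorm_mirror cosB sinB cospi sinpi r1 i1.
by split; ring.
Qed.

Lemma int_sector_finite al be r : finite_set (int_sector al be r).
Proof. apply: (@sub_finite_set _ _ (int_disc (r ^+ 2))); first by move=> a [].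
exact: (int_disc_finite w0 Obas). Qed.

Lemma int_sector_split al be ga r : al <= be -> be <= ga -> ga <= al + 2 * pi ->
  ncard (int_sector al ga r) = (ncard (int_sector al be r) + ncard (int_sector be ga r))%N.
Proof.
move=> ab bg ga_; rewrite -ncardU; [|exact: int_sector_finite|exact: int_sector_finite|].
- congr ncard; apply/seteqP; split => a.
    move=> [Oa a0 ar [t /andP[t1 t2] at_]]; have [tb|tb] := leP t be.
      by left; split=> //; exists t => //; rewrite t1.
    by right; split=> //; exists t => //; rewrite tb.
  move=> [|] [Oa a0 ar [t /andP[t1 t2] at_]]; split=> //; exists t => //; apply/andP; split; lra.
- move=> a [Oa a0 ar [t /andP[t1 t2] at_]] [_ _ _ [s /andP[s1 s2] as_]].
  have E : t = s by apply: has_arg_uniq at_ as_ _ => //; rewrite ltr_norml; apply/andP; split; lra.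
  by lra.
Qed.

Lemma int_sector_add2pi al be r : int_sector (al + 2 * pi) (be + 2 * pi) r = int_sector al be r.
Proof.
apply/seteqP; split => a [Oa a0 ar [t /andP[t1 t2] at_]]; split => //.
  exists (t - 2 * pi); first by apply/andP; split; lra.
  by apply/has_arg_add2pi; rewrite subrK.
exists (t + 2 * pi); first by apply/andP; split; lra.
exact/has_arg_add2pi.
Qed.

Lemma int_sector_opp_sub al be r a : int_sector al be r a -> int_sector (al + pi) (be + pi) r (- a).
Proof.
move=> [Oa a0 ar [t /andP[t1 t2] at_]]; split; rewrite ?oppr_eq0 ?qnormN//.
  exact: OKN.
by exists (t + pi); [apply/andP; split; lra|exact: has_arg_opp].
Qed.

Lemma card_int_sector_opp al be r : ncard (int_sector (al + pi) (be + pi) r) = ncard (int_sector al be r).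
Proof.
rewrite -(@ncard_image _ _ (int_sector al be r) -%R); [|exact: int_sector_finite|by move=> x y _ _ /oppr_inj].
congr ncard; apply/seteqP; split => a.
  move=> /int_sector_opp_sub H; exists (- a); last exact: opprK.
  by rewrite -(int_sector_add2pi al); move: H; congr (int_sector _ _ _ _); ring.
by move=> [b /int_sector_opp_sub H <-].
Qed.

Section Fixed.
Variable r : R.
Hypothesis r1 : 1 <= r.
Let k := r ^+ 2 / (2 * h).
Let C1 := (5 + h^-1) * r.

Let pos_angle a s : 0 < s <= 2 * pi -> has_arg a s -> 0 < im a -> 0 < s < pi.
Proof.
move=> /andP[s0 s2] [_ aE] ia; rewrite s0 /= ltNge; apply/negP => ps.
have : 0 <= sin (s - pi) by apply: sin_ge0_pi; apply/andP; split; lra.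
have -> : sin (s - pi) = - sin s by rewrite -[in RHS](subrK pi s) sinDpi opprK.
rewrite oppr_ge0 => sn; move: ia; rewrite aE ltNge => /negP; apply.
by rewrite mulr_ge0_le0.
Qed.

Let below a s u : 0 <= u -> u <= pi / 2 -> 0 < s < pi -> has_arg a s ->
  im a * cos u < re a * sin u -> s < u.
Proof.
move=> u0 up /andP[s0 sp] [rE iE] H; rewrite ltNge; apply/negP => us.
have : 0 <= sin (s - u) by apply: sin_ge0_pi; apply/andP; split; lra.
rewrite sinB leNgt => /negP; apply.
have q0 := sqrtr_ge0 (qnorm a).
move: H; rewrite rE iE -subr_gt0 => H.
have {}H : 0 < Num.sqrt (qnorm a) * (cos s * sin u - sin s * cos u) by move: H; lra.
rewrite -subr_lt0 -opprB oppr_lt0 subr0 in H *.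
have q1 : 0 < Num.sqrt (qnorm a).
  rewrite lt_def q0 andbT; apply/eqP => z; by move: H; rewrite z mul0r ltxx.
by move: H; rewrite pmulr_rgt0//; lra.
Qed.

Let above a t u : 0 <= t -> t <= u -> u <= pi / 2 -> has_arg a t ->
  [/\ 0 <= im a, 0 <= re a & im a * cos u <= re a * sin u].
Proof.
move=> t0 tu up [rE iE]; have pi0 := @pi_gt0 R; have q0 := sqrtr_ge0 (qnorm a).
split.
- by rewrite iE mulr_ge0// sin_ge0_pi//; apply/andP; split; lra.
- by rewrite rE mulr_ge0// cos_ge0_pihalf//; apply/andP; split; lra.
- rewrite -subr_ge0 rE iE.
  have -> : Num.sqrt (qnorm a) * cos t * sin u - Num.sqrt (qnorm a) * sin t * cos u =
     Num.sqrt (qnorm a) * sin (u - t) by rewrite sinB; ring.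
  by rewrite mulr_ge0// sin_ge0_pi//; apply/andP; split; lra.
Qed.

Lemma card_int_sector_first u : 0 <= u -> u <= pi / 2 ->
  `|(ncard (int_sector 0 u r))%:R - u * k| <= C1.
Proof.
move=> u0 up; rewrite /k mulrA; apply: (card_first_quadrant_sector Ow w0 Obas) => //.
  move=> a Oa ia H ar; have a0 : a != 0 by apply: contraTneq ia => ->; rewrite im0 ltxx.
  have [s s0 as_] := has_arg_ex a0; have sp := pos_angle s0 as_ ia.
  split => //; exists s => //; have := below u0 up sp as_ H; case/andP: sp => -> _ /ltW ->//.
by move=> a [Oa a0 ar [t /andP[/ltW t0 tu] /(above t0 tu up)[? ? ?]]].
Qed.

Lemma card_int_sector_second u : 0 <= u -> u <= pi / 2 ->
  `|(ncard (int_sector (pi - u) pi r))%:R - u * k| <= C1.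
Proof.
move=> u0 up; rewrite /k mulrA.
rewrite -(@ncard_image _ _ _ mirror); [|exact: int_sector_finite|by move=> x y _ _ /(can_inj mirrorK)].
apply: (card_first_quadrant_sector Ow w0 Obas) => //.
  move=> a Oa ia H ar; have a0 : a != 0 by apply: contraTneq ia => ->; rewrite im0 ltxx.
  have [s s0 as_] := has_arg_ex a0; have sp := pos_angle s0 as_ ia.
  exists (mirror a); last exact: mirrorK.
  split; rewrite ?mirror_neq0 ?qnorm_mirror//; first exact: OK_mirror.
  exists (pi - s); last exact: has_arg_mirror.
  by have := below u0 up sp as_ H; case/andP: sp => ? ? ?; apply/andP; split; lra.
move=> _ [a [Oa a0 ar [t /andP[t0 tu] /has_arg_mirror at_]] <-].
have t1 : 0 <= pi - t by lra.
have t2 : pi - t <= u by lra.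
have [? ? ?] := above t1 t2 up at_.
by split; rewrite ?qnorm_mirror//; exact: OK_mirror.
Qed.

(** Beyond a right angle, add the second quadrant and remove the sector that ends
    at the negative real axis. *)
Lemma card_int_sector_half t : 0 <= t -> t <= pi -> `|(ncard (int_sector 0 t r))%:R - t * k| <= 3 * C1.
Proof.
move=> t0 tp; have pi0 := @pi_gt0 R.
have r1' := r1; have C0 : 0 <= C1 by rewrite mulr_ge0 ?addr_ge0 ?invr_ge0 ?(ltW w0)//; lra.
have [t2|t2] := leP t (pi / 2); first by apply: le_trans (card_int_sector_first t0 t2) _; lra.
have p2 : 0 <= pi / 2 :> R by lra.
have := card_int_sector_first p2 (lexx _); have := card_int_sector_second p2 (lexx _).
have u1 : 0 <= pi - t by lra. have u2 : pi - t <= pi / 2 by lra.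
have := card_int_sector_second u1 u2.
have -> : pi - (pi - t) = t by ring.
have -> : pi - pi / 2 = pi / 2 :> R by field.
have -> : ncard (int_sector 0 t r) = (ncard (int_sector 0 (pi / 2) r) + ncard (int_sector (pi / 2) t r))%N.
  by apply: int_sector_split; lra.
have -> : ncard (int_sector (pi / 2) pi r) = (ncard (int_sector (pi / 2) t r) + ncard (int_sector t pi r))%N.
  by apply: int_sector_split; lra.
rewrite !natrD !ler_norml => /andP[? ?] /andP[? ?] /andP[? ?].
by apply/andP; split; lra.
Qed.

(** The opposite of a sector of the upper half plane covers what lies beyond a
    half turn. *)
Lemma card_int_sector_full t : 0 <= t -> t <= 2 * pi -> `|(ncard (int_sector 0 t r))%:R - t * k| <= 6 * C1.
Proof.
move=> t0 tp; have pi0 := @pi_gt0 R.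
have r1' := r1; have C0 : 0 <= C1 by rewrite mulr_ge0 ?addr_ge0 ?invr_ge0 ?(ltW w0)//; lra.
have [t2|t2] := leP t pi; first by apply: le_trans (card_int_sector_half t0 t2) _; lra.
have p0 : 0 <= pi :> R by lra.
have u1 : 0 <= t - pi by lra. have u2 : t - pi <= pi by lra.
have := card_int_sector_half p0 (lexx _); have := card_int_sector_half u1 u2.
have -> : ncard (int_sector 0 t r) = (ncard (int_sector 0 pi r) + ncard (int_sector pi t r))%N.
  by apply: int_sector_split; lra.
have -> : ncard (int_sector pi t r) = ncard (int_sector 0 (t - pi) r).
  by rewrite -(card_int_sector_opp 0) add0r subrK.
rewrite !natrD !ler_norml => /andP[? ?] /andP[? ?].
by apply/andP; split; lra.
Qed.

(** A difference of two sectors that start at the positive real axis, after a cut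
    there if the sector contains it. *)
Lemma card_int_sector_nneg al be : 0 <= al -> al <= 2 * pi -> al <= be -> be <= al + 2 * pi ->
  `|(ncard (int_sector al be r))%:R - (be - al) * k| <= 18 * C1.
Proof.
move=> a0 a2 ab b2; have pi0 := @pi_gt0 R.
have r1' := r1; have C0 : 0 <= C1 by rewrite mulr_ge0 ?addr_ge0 ?invr_ge0 ?(ltW w0)//; lra.
have [bp|bp] := leP be (2 * pi).
  have b0 : 0 <= be by lra.
  have := card_int_sector_full a0 a2; have := card_int_sector_full b0 bp.
  have -> : ncard (int_sector 0 be r) = (ncard (int_sector 0 al r) + ncard (int_sector al be r))%N.
    by apply: int_sector_split; lra.
  by rewrite !natrD !ler_norml => /andP[? ?] /andP[? ?]; apply/andP; split; lra.
have p0 : 0 <= 2 * pi :> R by lra.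
have u1 : 0 <= be - 2 * pi by lra. have u2 : be - 2 * pi <= 2 * pi by lra.
have := card_int_sector_full a0 a2; have := card_int_sector_full p0 (lexx _); have := card_int_sector_full u1 u2.
have -> : ncard (int_sector 0 (2 * pi) r) = (ncard (int_sector 0 al r) + ncard (int_sector al (2 * pi) r))%N.
  by apply: int_sector_split; lra.
have -> : ncard (int_sector al be r) = (ncard (int_sector al (2 * pi) r) + ncard (int_sector (2 * pi) be r))%N.
  by apply: int_sector_split; lra.
have -> : int_sector 0 (be - 2 * pi) r = int_sector (2 * pi) be r by rewrite -int_sector_add2pi add0r subrK.
by rewrite !natrD !ler_norml => /andP[? ?] /andP[? ?] /andP[? ?]; apply/andP; split; lra.
Qed.

Lemma card_int_sector al be : - (2 * pi) <= al -> al <= 2 * pi -> al <= be -> be <= al + 2 * pi ->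
  `|(ncard (int_sector al be r))%:R - (be - al) * k| <= 18 * C1.
Proof.
move=> a0 a2 ab b2; have [a3|a3] := leP 0 al; first exact: card_int_sector_nneg.
rewrite -int_sector_add2pi.
have -> : be - al = (be + 2 * pi) - (al + 2 * pi) by ring.
by apply: card_int_sector_nneg; lra.
Qed.
End Fixed.

Local Notation normc := (@ComplexField.Normc.normc R).

Lemma iota_sector (z : complex R) (tau th x : R) : 0 <= x -> z != 0 ->
  z = Complex (normc z * cos tau) (normc z * sin tau) ->
  O `&` iota @^-1` angular_sector z th x = int_sector (tau - th / 2) (tau + th / 2) x.
Proof.
move=> x0 z0 zE; have n0 : 0 < normc z.
  rewrite lt_def; apply/andP; split; last by case: (z) => ? ?; exact: sqrtr_ge0.
  by apply: contraNneq z0 => /ComplexField.Normc.eq0_normc ->.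
have key rho t : Complex (rho * cos t) (rho * sin t) * z =
    Complex (rho * normc z * cos (t + tau)) (rho * normc z * sin (t + tau)).
  rewrite {1}zE cosD sinD; move: (normc z) => n.
  by apply/eqP; rewrite eq_complex /=; apply/andP; split; apply/eqP; ring.
apply/seteqP; split => a.
  move=> [Oa [rho [t [/andP[t1 t2] /andP[p1 p2] aE]]]].
  have rE : re a = rho * normc z * cos (t + tau) by rewrite aE key.
  have iE : im a = rho * normc z * sin (t + tau) by rewrite aE key.
  have nE : qnorm a = (rho * normc z) ^+ 2.
    by rewrite /qnorm rE iE -[RHS]mulr1 -(cos2Dsin2 (t + tau)); ring.
  have pn : 0 < rho * normc z by rewrite mulr_gt0.
  split=> //.
  - by rewrite -(qnorm_eq0 iota) nE sqrf_eq0 gt_eqF.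
  - by rewrite nE ler_sqr ?nnegrE ?(ltW pn)// -ler_pdivlMr.
  - exists (t + tau); first by apply/andP; split; lra.
    by rewrite /has_arg nE sqrtr_sqr gtr0_norm.
move=> [Oa a0 ax [t /andP[t1 t2] [rE iE]]]; split => //.
have s0 : 0 < Num.sqrt (qnorm a) by rewrite sqrtr_gt0 qnorm_gt0.
exists (Num.sqrt (qnorm a) / normc z), (t - tau); split.
- by apply/andP; split; lra.
- rewrite divr_gt0//= ler_pM2r ?invr_gt0// -ler_sqr ?nnegrE ?(ltW s0)//.
  by rewrite sqr_sqrtr ?qnorm_ge0.
- by rewrite key subrK divfK ?gt_eqF// -rE -iE; case: (iota a).
Qed.

Lemma sector_polar (z : complex R) : z != 0 -> exists2 tau, 0 < tau <= 2 * pi &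
  z = Complex (normc z * cos tau) (normc z * sin tau).
Proof.
case: z => x y z0; have : 0 < x ^+ 2 + y ^+ 2.
  rewrite lt_def addr_ge0 ?sqr_ge0// andbT; apply: contraNneq z0 => /eqP.
  by rewrite paddr_eq0 ?sqr_ge0// !sqrf_eq0 => /andP[/eqP -> /eqP ->].
by move=> /polar_coordinates[t [? xE yE]]; exists t => //=; rewrite -xE -yE.
Qed.

(** Abel summation: the number of k < M with N a <= k is M - N a. *)
Lemma sum_nat_layers (T : eqType) (s : seq T) (N : T -> nat) (M : nat) :
  (forall a, a \in s -> (N a <= M)%N) ->
  (\sum_(a <- s) N a + \sum_(0 <= k < M) count (fun a => N a <= k)%N s = M * size s)%N.
Proof.
elim: s => [|a s IH] sM.
  by rewrite big_nil big1_eq muln0.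
have {}IH := IH (fun b bs => sM b (@mem_behead _ (a :: s) b bs)).
rewrite big_cons /= big_split /= mulnS -IH.
suff -> : (\sum_(0 <= k < M) (N a <= k)%N = M - N a)%N.
  by have := sM a (mem_head a s); lia.
have := sM a (mem_head a s) => aM.
rewrite (@big_cat_nat _ _ _ (N a))//= big_nat_cond big1 ?add0n; last first.
  by move=> k /andP[/andP[_ ka] _]; rewrite leqNgt ka.
rewrite big_nat_cond (eq_bigr (fun => 1%N)); last by move=> k /andP[/andP[-> ]].
by rewrite -big_nat_cond sum_nat_const_nat muln1.
Qed.

(** The values |a|^2 are natural numbers, so Abel summation expresses their sum by
    the numbers of points in the sectors of radius sqrt k for k <= r^2, each of
    which is known up to O(r).  For r < 1 there is no point, and r^4 <= r^3. *)
Lemma int_sector_sum : exists2 C : R, 0 < C & forall al be r : R,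
  - (2 * pi) <= al -> al <= 2 * pi -> al <= be -> be <= al + 2 * pi -> 0 < r ->
  `|\sum_(a \in int_sector al be r) qnorm a - (be - al) * r ^+ 4 / (4 * h)| <= C * r ^+ 3.
Proof.
(* C2 r bounds the error of each count, and the counts enter twice, in B and in
   the size of s; 8 pi / h pays for replacing r^2 by its integer part M, and for
   the main term if r < 1. *)
pose C2 := 18 * (5 + h^-1); pose C := 2 * C2 + 8 * pi / h.
have h0 := w0; have pi0 := @pi_gt0 R.
have hi0 : 0 < h^-1 by rewrite invr_gt0.
have ph : 0 < pi / h by rewrite mulr_gt0.
have C20 : 0 < C2 by rewrite /C2; lra.
have C0 : 0 < C by rewrite /C -mulrA; lra.
exists C => // al be r a1 a2 ab b2 r0.
have fS := int_sector_finite al be r; have [s [us sE sz]] := finite_list fS.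
have -> : \sum_(a \in int_sector al be r) qnorm a = \sum_(a <- s) qnorm a.
  exact: fsbig_list.
pose k := (be - al) / (2 * h).
have k0 : 0 <= k by rewrite divr_ge0 ?subr_ge0// mulr_ge0// ltW.
have kC : k <= pi / h.
  rewrite /k ler_pdivrMr ?mulr_gt0//.
  have -> : pi / h * (2 * h) = 2 * pi by field; rewrite gt_eqF.
  lra.
have -> : (be - al) * r ^+ 4 / (4 * h) = k * r ^+ 4 / 2.
  by rewrite /k; field; rewrite gt_eqF.
have [r1|r1] := ltP r 1.
  have -> : s = [::].
    case: (s) sE => // a s' sE'; have [Oa a0 ar _] : int_sector al be r a by apply/sE'; rewrite mem_head.
    have := OK_qnorm_ge1 hIQ Oa a0; rewrite leNgt => /negP; case.
    by apply: le_lt_trans ar _; rewrite expr_lt1// ltW.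
  rewrite big_nil sub0r normrN ger0_norm; last by rewrite divr_ge0// mulr_ge0// exprn_ge0// ltW.
  have r3 : 0 <= r ^+ 3 by rewrite exprn_ge0// ltW.
  have : k * r ^+ 4 <= (pi / h) * r ^+ 3.
    apply: ler_pM => //; first by rewrite exprn_ge0// ltW.
    by rewrite exprS ger_pMl// ?exprn_gt0// ltW.
  have : (pi / h) * r ^+ 3 * 2 <= C * r ^+ 3.
    by rewrite mulrAC ler_wpM2r// /C -mulrA; lra.
  have : 0 <= (pi / h) * r ^+ 3 by rewrite mulr_ge0// ltW.
  lra.
pose N a := Num.truncn (qnorm a); pose M := Num.truncn (r ^+ 2).
have NE a : a \in s -> qnorm a = (N a)%:R.
  by move=> /sE[/(OK_qnorm hIQ)[n nE] _ _ _]; rewrite /N nE natrK.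
have r20 : 0 <= r ^+ 2 by exact: sqr_ge0.
have ML : M%:R <= r ^+ 2 by rewrite truncn_le.
have MG : r ^+ 2 < M.+1%:R by rewrite truncnS_gt.
have NM a : a \in s -> (N a <= M)%N.
  by move=> /sE[_ _ ar _]; exact: le_truncn.
have := sum_nat_layers NM => /(congr1 (fun n => n%:R : R)).
rewrite natrD natrM !natr_sum -(eq_big_seq _ NE).
have cntE kk : (kk < M)%N -> `|(count (fun a => N a <= kk)%N s)%:R - k * kk%:R| <= C2 * r.
  move=> kM.
  have cE : count (fun a => N a <= kk)%N s = ncard (int_sector al be (Num.sqrt kk%:R)).
    rewrite -size_filter; apply/esym/ncard_seq; first exact: filter_uniq.
    move=> a; rewrite mem_filter /int_sector /= sqr_sqrtr//; split.
      move=> [Oa a0 ak ta]; have as_ : a \in s.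
        apply/sE; split=> //; apply: (le_trans ak); apply: le_trans ML; rewrite ler_nat ltnW//.
      by rewrite as_ andbT -(ler_nat R) -NE.
    by move=> /andP[+ as_]; rewrite -(ler_nat R) -NE// => H; move: as_ => /sE[? ? _ ?]; split.
  rewrite cE; case: kk kM {cE} => [|kk] kM.
    rewrite mulr0 subr0 ncard0; first by rewrite normr0 (mulr_ge0 (ltW C20) (ltW r0)).
    move=> a [Oa a0]; rewrite sqr_sqrtr// => a1' _.
    by have := OK_qnorm_ge1 hIQ Oa a0; lra.
  have s1 : 1 <= Num.sqrt kk.+1%:R :> R.
    by rewrite -{1}sqrtr1 ler_sqrt// ler1n.
  have := card_int_sector s1 a1 a2 ab b2.
  rewrite sqr_sqrtr// => H.
  have -> : k * kk.+1%:R = (be - al) * (kk.+1%:R / (2 * h)) by rewrite /k; ring.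
  apply: (le_trans H); rewrite /C2 -mulrA ler_pM2l// ler_pM2l; last lra.
  rewrite -[leRHS](gtr0_norm r0) -sqrtr_sqr ler_sqrt//.
  by apply: le_trans ML; rewrite ler_nat ltnW.
have szE : `|(size s)%:R - k * r ^+ 2| <= C2 * r.
  have := card_int_sector r1 a1 a2 ab b2; rewrite -sz.
  by rewrite /C2 -[18 * _ * r]mulrA; have -> : k * r ^+ 2 = (be - al) * (r ^+ 2 / (2 * h)) by rewrite /k; ring.
set A := \sum_(a <- s) qnorm a; set B := \sum_(0 <= _ < M) _ => AB.
have BE : `|B - k * (M%:R * (M%:R - 1) / 2)| <= M%:R * (C2 * r).
  have -> : k * (M%:R * (M%:R - 1) / 2) = \sum_(0 <= j < M) k * j%:R.
    by rewrite -mulr_sumr sum_natr.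
  rewrite -sumrB; apply: le_trans (ler_norm_sum _ _ _) _.
  rewrite mulr_natl -[M in _ *+ M]subn0 -sumr_const_nat.
  by apply: ler_sum_nat => j /andP[_ jM]; exact: cntE.
have SE : `|M%:R * (size s)%:R - M%:R * (k * r ^+ 2)| <= M%:R * (C2 * r).
  by rewrite -mulrBr normrM normr_nat ler_wpM2l.
have AE : A = M%:R * (size s)%:R - B by rewrite -AB addrK.
have T : `|M%:R * (k * r ^+ 2) - k * (M%:R * (M%:R - 1) / 2) - k * r ^+ 4 / 2| <= k * (2 * r ^+ 2).
  set e := r ^+ 2 - M%:R.
  have e0 : 0 <= e by rewrite subr_ge0.
  have e1 : e <= 1 by move: MG; rewrite /e -natr1; lra.
  have -> : M%:R * (k * r ^+ 2) - k * (M%:R * (M%:R - 1) / 2) - k * r ^+ 4 / 2 =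
     k * ((r ^+ 2 - e ^+ 2 - e) / 2).
    by rewrite /e; field.
  rewrite normrM (ger0_norm k0) ler_wpM2l//.
  have r2 : 1 <= r ^+ 2 by rewrite expr_ge1// ltW.
  have e2 : e ^+ 2 <= 1 by rewrite expr_le1.
  have e3 := sqr_ge0 e.
  by rewrite ler_norml; apply/andP; split; lra.
have MC : M%:R * (C2 * r) <= C2 * r ^+ 3.
  have -> : C2 * r ^+ 3 = r ^+ 2 * (C2 * r) by ring.
  exact: ler_wpM2r (mulr_ge0 (ltW C20) (ltW r0)) _ _ ML.
have kr : k * (2 * r ^+ 2) <= 8 * pi / h * r ^+ 3.
  apply: (@le_trans _ _ (pi / h * (2 * r ^+ 2))).
    by rewrite ler_wpM2r// mulr_ge0.
  have : r ^+ 2 <= r ^+ 3 by rewrite [leRHS]exprS ler_peMl.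
  have r3 : 0 <= r ^+ 3 by rewrite exprn_ge0// ltW.
  move=> r23; have : pi / h * r ^+ 2 <= pi / h * r ^+ 3 by rewrite ler_wpM2l// ltW.
  have : 0 <= pi / h * r ^+ 3 by rewrite mulr_ge0// ltW.
  lra.
have CE : C * r ^+ 3 = C2 * r ^+ 3 + C2 * r ^+ 3 + 8 * pi / h * r ^+ 3 by rewrite /C; ring.
rewrite AE CE; move: BE SE T; rewrite !ler_norml => /andP[? ?] /andP[? ?] /andP[? ?].
by apply/andP; split; lra.
Qed.

(** One constant serves for all z, all angles and all r > 0, which allows the
    rotation and the contraction of the sector by a generator of m. *)
Lemma sector_sum : exists2 C : R, 0 < C & forall (z : complex R) (th r : R),
  z != 0 -> 0 < th <= 2 * pi -> 0 < r ->
  finite_set (O `&` iota @^-1` angular_sector z th r) /\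
  `|\sum_(a \in O `&` iota @^-1` angular_sector z th r) qnorm a - th * r ^+ 4 / (4 * h)| <= C * r ^+ 3.
Proof.
have [C C0 HC] := int_sector_sum; exists C => // z th r z0 /andP[t0 t2] r0.
have [tau /andP[u0 u2] zE] := sector_polar z0.
rewrite (iota_sector th (ltW r0) z0 zE); split; first exact: int_sector_finite.
have := HC (tau - th / 2) (tau + th / 2) r.
have -> : (tau + th / 2) - (tau - th / 2) = th by field.
by apply => //; lra.
Qed.

End SectorCount.

(** * The sieve over finitely many primes *)

Section Sieve.
Variables (R : realType) (K : fieldExtType rat).
Variable iota : {rmorphism K -> complex R}.
Local Notation O := (@ring_of_integers K).
Local Notation PI := principal_ideal.
Local Notation qnorm := (qnorm iota).
Hypothesis hIQ : imaginary_quadratic iota.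
Hypothesis hP : principal_ring_of_integers K.
Local Notation normc := (@ComplexField.Normc.normc R).

Definition Nm (P : set K) : R := (ideal_norm P)%:R.

Variables (h C0 : R).
Hypotheses (h0 : 0 < h) (C00 : 0 < C0).
Hypothesis sector_bound : forall (z : complex R) (th r : R),
  z != 0 -> 0 < th <= 2 * pi -> 0 < r ->
  finite_set (O `&` iota @^-1` angular_sector z th r) /\
  `|\sum_(a \in O `&` iota @^-1` angular_sector z th r) qnorm a - th * r ^+ 4 / (4 * h)| <= C0 * r ^+ 3.

(** Euler's function with the Euler factors of the primes of S only. *)
Definition sieved_phi (S : seq (set K)) (a : K) : R :=
  qnorm a * \prod_(P <- S | `[< P a >]) (1 - (Nm P)^-1).
(** The density of bO times the mean over bO of the Euler factors of S: if P does
    not contain b, one multiple of b out of N(P) lies in P, and the mean is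
    1 - 1/N(P)^2. *)
Definition sieved_density (S : seq (set K)) (b : K) : R :=
  (qnorm b)^-1 * \prod_(P <- S) (if `[< P b >] then 1 - (Nm P)^-1 else 1 - (Nm P)^-1 ^+ 2).
(** The second summand is N(P)^(-3/2). *)
Definition sieve_err (S : seq (set K)) : R :=
  \prod_(P <- S) (1 + (Nm P)^-1 / Num.sqrt (Nm P)).

Lemma normc_iota a : normc (iota a) = Num.sqrt (qnorm a).
Proof. by rewrite /qnorm; case: (iota a). Qed.

Lemma mul_sector b y z th x : b != 0 ->
  (iota @^-1` angular_sector z th x) (b * y) <->
  (iota @^-1` angular_sector (z / iota b) th (x / Num.sqrt (qnorm b))) y.
Proof.
move=> b0; have ib : iota b != 0 by rewrite fmorph_eq0.
have s0 : Num.sqrt (qnorm b) != 0 by rewrite gt_eqF// sqrtr_gt0 qnorm_gt0.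
have E : x / Num.sqrt (qnorm b) / normc (z / iota b) = x / normc z.
  rewrite ComplexField.Normc.normcM ComplexField.Normc.normcV normc_iota.
  by rewrite invfM invrK mulrACA mulVf// mulr1.
rewrite /angular_sector /= E rmorphM; split => -[rho [t [t1 r1 zE]]]; exists rho, t; split=> //.
  by rewrite mulrA -zE mulrAC mulfV// mul1r.
by rewrite zE mulrCA [iota b * _]mulrC -[z / _ * _]mulrA mulVf// mulr1.
Qed.

Section Fixed.
Variables (z : complex R) (th x : R).
Hypotheses (z0 : z != 0) (th0 : 0 < th <= 2 * pi) (x0 : 0 < x).
Local Notation X := (iota @^-1` angular_sector z th x).
Let k := th / (4 * h).

Lemma PI_sector_finite b : O b -> finite_set (PI b `&` X).
Proof.
move=> Ob; apply: (@sub_finite_set _ _ (O `&` X)); last by have [] := sector_bound z0 th0 x0.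
by move=> a [[c Oc <-] Xa]; split => //; exact: OKM.
Qed.

Lemma sieve_nil b : O b -> b != 0 ->
  `|\sum_(a \in PI b `&` X) qnorm a - k * x ^+ 4 / qnorm b| <= C0 * x ^+ 3 / Num.sqrt (qnorm b).
Proof.
move=> Ob b0; set bb := Num.sqrt (qnorm b).
have nb := qnorm_gt0 iota b0.
have bb0 : 0 < bb by rewrite sqrtr_gt0.
have nbE : qnorm b = bb ^+ 2 by rewrite sqr_sqrtr// ltW.
have z1 : z / iota b != 0 by rewrite mulf_neq0// invr_eq0 fmorph_eq0.
have x1 : 0 < x / bb by rewrite divr_gt0.
have [_] := sector_bound z1 th0 x1; set Y := O `&` _ => H.
have -> : PI b `&` X = [set b * y | y in Y].
  apply/seteqP; split => [_ [[y Oy <-] /(mul_sector _ _ _ _ b0) H']|_ [y [Oy H'] <-]].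
    by exists y.
  by split; [exists y|exact/(mul_sector _ _ _ _ b0)].
rewrite fsbig_image/=; last by move=> u v _ _; exact: (mulfI b0).
under eq_fsbigr do rewrite qnormM.
rewrite -mulr_fsumr.
have -> : qnorm b * \sum_(i \in Y) qnorm i - k * x ^+ 4 / qnorm b =
   qnorm b * (\sum_(i \in Y) qnorm i - th * (x / bb) ^+ 4 / (4 * h)).
  by rewrite /k nbE; field; rewrite !gt_eqF.
rewrite normrM (gtr0_norm nb); apply: (le_trans (ler_wpM2l (ltW nb) H)).
by rewrite le_eqVlt; apply/orP; left; apply/eqP; rewrite nbE; field; rewrite gt_eqF.
Qed.

Lemma sieve_err_ge1 S : 1 <= sieve_err S.
Proof.
rewrite /sieve_err; elim: S => [|P S IH]; first by rewrite big_nil.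
rewrite big_cons -[leLHS]mulr1; apply: ler_pM => //.
by rewrite lerDl divr_ge0 ?sqrtr_ge0// invr_ge0.
Qed.

(** The induction on S must hold for all b at once: if P = pO does not contain b,
    the terms that receive the factor 1 - 1/N(P) are those of bpO, and the
    hypothesis is used for both b and b p. *)
Lemma sieve S : uniq S -> (forall P, P \in S -> nonzero_prime_ideal P) ->
  forall b, O b -> b != 0 ->
  `|\sum_(a \in PI b `&` X) sieved_phi S a - k * x ^+ 4 * sieved_density S b| <=
  C0 * x ^+ 3 * sieve_err S / Num.sqrt (qnorm b).
Proof.
elim: S => [|P S IH] /=.
  move=> _ _ b Ob b0; under eq_fsbigr do rewrite /sieved_phi big_nil mulr1.
  by rewrite /sieved_density /sieve_err !big_nil !mulr1; exact: sieve_nil.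
move=> /andP[PS uS] prS b Ob b0.
have pP : nonzero_prime_ideal P by apply: prS; rewrite mem_head.
have prS' Q : Q \in S -> nonzero_prime_ideal Q by move=> QS; apply: prS; rewrite in_cons QS orbT.
have [p [Op p0 PE Np p2]] := prime_gen hIQ hP pP.
have hPi := prime_is_ideal pP.
have {}IH := IH uS prS'.
have N2 : 2 <= Nm P by rewrite /Nm -Np.
have N0 : 0 < Nm P by lra.
have Ni0 : 0 < (Nm P)^-1 by rewrite invr_gt0.
have Ni1 : (Nm P)^-1 <= 1 by rewrite invf_le1//; lra.
have [l [ul lE _]] := finite_list (PI_sector_finite Ob).
rewrite (fsbig_list _ _ ul lE).
have IHb := IH b Ob b0; rewrite (fsbig_list _ _ ul lE) in IHb.
have e1 := sieve_err_ge1 S.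
have sb : 0 < Num.sqrt (qnorm b) by rewrite sqrtr_gt0 qnorm_gt0.
have x3 : 0 < x ^+ 3 by rewrite exprn_gt0.
have [Pb|Pb] := pselect (P b).
  have -> : \sum_(a <- l) sieved_phi (P :: S) a = (1 - (Nm P)^-1) * \sum_(a <- l) sieved_phi S a.
    rewrite mulr_sumr; apply: eq_big_seq => a /lE[[c Oc cE] _].
    have Pa : P a by rewrite -cE; exact: idealMr.
    by rewrite /sieved_phi big_cons asboolT// mulrCA.
  have -> : sieved_density (P :: S) b = (1 - (Nm P)^-1) * sieved_density S b.
    by rewrite /sieved_density big_cons asboolT// mulrCA.
  rewrite [k * _ * (_ * _)]mulrCA -mulrBr normrM ger0_norm ?subr_ge0//.
  apply: (@le_trans _ _ (1 * (C0 * x ^+ 3 * sieve_err S / Num.sqrt (qnorm b)))).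
    by apply: ler_pM => //; rewrite ?subr_ge0// lerBlDr lerDl ltW.
  rewrite mul1r ler_pM2r ?invr_gt0// ler_pM2l ?mulr_gt0//.
  rewrite /sieve_err big_cons ler_peMl//; first by rewrite (le_trans _ e1).
  by rewrite lerDl divr_ge0 ?sqrtr_ge0// ltW.
have Obp : O (b * p) by exact: OKM.
have bp0 : b * p != 0 by rewrite mulf_neq0.
have lP a : (PI (b * p) `&` X) a <-> a \in [seq a <- l | `[< P a >]].
  rewrite mem_filter; split.
    move=> [[c Oc cE] Xa]; apply/andP; split.
      apply/asboolP; rewrite -cE; apply: idealMr => //; apply: idealMl => //.
      by rewrite PE; exact: PI_id.
    by apply/lE; split => //; exists (p * c); [exact: OKM|rewrite mulrA].
  move=> /andP[/asboolP Pa /lE[[c Oc cE] Xa]]; split => //.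
  move: Pa; rewrite -cE => /(primeM pP Ob Oc)[//|]; rewrite PE => -[d Od <-].
  by exists d => //; rewrite mulrA.
have IHbp := IH _ Obp bp0; rewrite (fsbig_list _ _ (filter_uniq _ ul) lP) big_filter in IHbp.
have -> : \sum_(a <- l) sieved_phi (P :: S) a = \sum_(a <- l) sieved_phi S a -
    (Nm P)^-1 * \sum_(a <- l | `[< P a >]) sieved_phi S a.
  rewrite mulr_sumr [in X in _ - X]big_mkcond -sumrB; apply: eq_bigr => a _.
  rewrite /sieved_phi big_cons; case: ifP => _; last by rewrite subr0.
  by rewrite mulrCA mulrBl mul1r.
have mE : sieved_density S (b * p) = (Nm P)^-1 * sieved_density S b.
  rewrite /sieved_density qnormM Np -/(Nm P) invfM [_^-1 / _]mulrC -mulrA; congr (_ * (_ * _)).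
  apply: eq_big_seq => Q QS; have pQ := prS' Q QS.
  have Qp : ~ Q p.
    by apply: (prime_neq hP pP pQ) => // QP; rewrite -QP QS in PS.
  suff -> : `[< Q (b * p) >] = `[< Q b >] by [].
  apply: asbool_equiv_eq; split => [/(primeM pQ Ob Op)[]//|Qb].
  by apply: idealMr => //; exact: prime_is_ideal.
have -> : sieved_density (P :: S) b = sieved_density S b - (Nm P)^-1 * sieved_density S (b * p).
  by rewrite mE /sieved_density big_cons asboolF//; ring.
have -> : sieve_err (P :: S) = sieve_err S + sieve_err S * ((Nm P)^-1 / Num.sqrt (Nm P)).
  by rewrite /sieve_err big_cons; ring.
set U := \sum_(a <- l) _ in IHb *; set V := \sum_(a <- l | _) _ in IHbp *.
have -> : U - (Nm P)^-1 * V - k * x ^+ 4 * (sieved_density S b - (Nm P)^-1 * sieved_density S (b * p)) =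
  (U - k * x ^+ 4 * sieved_density S b) - (Nm P)^-1 * (V - k * x ^+ 4 * sieved_density S (b * p)) by ring.
apply: (le_trans (ler_normB _ _)).
rewrite [C0 * x ^+ 3 * (_ + _)]mulrDr [(_ + _) / Num.sqrt (qnorm b)]mulrDl.
apply: lerD => //.
rewrite normrM gtr0_norm//.
have -> : C0 * x ^+ 3 * (sieve_err S * ((Nm P)^-1 / Num.sqrt (Nm P))) / Num.sqrt (qnorm b) =
  (Nm P)^-1 * (C0 * x ^+ 3 * sieve_err S / Num.sqrt (qnorm (b * p))).
  rewrite qnormM Np -/(Nm P) sqrtrM ?qnorm_ge0// invfM; ring.
by rewrite ler_pM2l.
Qed.

End Fixed.
End Sieve.

(** * Convergence of the sum of N(I)^(-3/2) *)

Lemma ler_sum_subseq (R : numDomainType) (T : eqType) (s t : seq T) (F : T -> R) :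
  uniq s -> uniq t -> {subset s <= t} -> (forall x, 0 <= F x) ->
  \sum_(x <- s) F x <= \sum_(x <- t) F x.
Proof.
move=> us ut st F0; rewrite [leRHS](bigID (mem s)) /= -[X in _ <= X + _]big_filter.
have -> : \sum_(x <- [seq x <- t | x \in s]) F x = \sum_(x <- s) F x.
  apply: perm_big; apply: uniq_perm => //; first exact: filter_uniq.
  by move=> x; rewrite mem_filter; apply: andb_idr; exact: st.
by rewrite lerDl sumr_ge0.
Qed.

Section EsumList.
Variables (R : realType) (T : choiceType).
Implicit Types (A : set T) (a : T -> R).

(** Sums over the ideals are compared through their finite partial sums, which are
    sums of real numbers over lists. *)
Lemma esum_le_list A a (M : R) :
  (forall s : seq T, uniq s -> (forall x, x \in s -> A x) -> \sum_(x <- s) a x <= M) ->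
  (\esum_(x in A) (a x)%:E <= M%:E)%E.
Proof.
move=> H; apply: ge_ereal_sup => _ [X [fX XA] <-].
have [s [us sE _]] := finite_list fX.
rewrite (fsbig_list _ _ us sE) sumEFin lee_fin; apply: H => // x /sE; exact: XA.
Qed.

Lemma esum_ge_list A a (s : seq T) : uniq s -> (forall x, x \in s -> A x) ->
  ((\sum_(x <- s) a x)%:E <= \esum_(x in A) (a x)%:E)%E.
Proof.
move=> us sA; apply: esum_ge; exists [set` s]; first by split=> //; exact: finite_seq.
by rewrite -fsbig_seq// sumEFin.
Qed.

Lemma esum_fin A a (M : R) : (forall x, 0 <= a x) ->
  (forall s : seq T, uniq s -> (forall x, x \in s -> A x) -> \sum_(x <- s) a x <= M) ->
  (\esum_(x in A) (a x)%:E = (fine (\esum_(x in A) (a x)%:E))%:E)%E.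
Proof.
move=> a0 /esum_le_list H; rewrite fineK// ge0_fin_numE; first by rewrite (le_lt_trans H)// ltry.
by apply: esum_ge0 => x _; rewrite lee_fin.
Qed.

Lemma esumZ_fin A a (c z : R) : 0 < c -> (forall x, 0 <= a x) ->
  \esum_(x in A) (a x)%:E = z%:E -> \esum_(x in A) (c * a x)%:E = (c * z)%:E.
Proof.
move=> c0 a0 E.
have up s : uniq s -> (forall x, x \in s -> A x) -> \sum_(x <- s) c * a x <= c * z.
  move=> us sA; rewrite -mulr_sumr ler_pM2l// -lee_fin -E; exact: esum_ge_list.
have ca0 x : 0 <= c * a x by rewrite mulr_ge0// ltW.
have F := esum_fin ca0 up; apply/eqP; rewrite eq_le esum_le_list//= F lee_fin.
rewrite mulrC -ler_pdivlMr// -lee_fin -E; apply: esum_le_list => s us sA.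
rewrite ler_pdivlMr// mulr_suml -lee_fin -F.
under eq_bigr do rewrite mulrC.
exact: esum_ge_list.
Qed.
End EsumList.

Section Summable.
Variable R : realType.

(** The power -3/2 of n + 1; the shift allows n = 0. *)
Definition pow_m32 (n : nat) : R := (n.+1%:R)^-1 / Num.sqrt n.+1%:R.

Lemma pow_m32_ge0 n : 0 <= pow_m32 n.
Proof. by rewrite divr_ge0 ?sqrtr_ge0// invr_ge0. Qed.

(** The partial sums are at most 3 - 2 / sqrt n, by comparison with the integral
    of the power -3/2. *)
Lemma sum_pow_m32 M : \sum_(0 <= n < M) pow_m32 n <= 3.
Proof.
have H n : \sum_(0 <= k < n.+1) pow_m32 k <= 3 - 2 / Num.sqrt n.+1%:R.
  elim: n => [|n IH].
    by rewrite big_nat1 /pow_m32 sqrtr1 invr1 !mulr1; lra.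
  rewrite big_nat_recr//= (le_trans (lerD IH (lexx _)))// /pow_m32.
  set s := Num.sqrt n.+1%:R; set t := Num.sqrt n.+2%:R.
  have s0 : 0 < s by rewrite sqrtr_gt0.
  have t0 : 0 < t by rewrite sqrtr_gt0.
  have sE : n.+1%:R = s ^+ 2 by rewrite sqr_sqrtr.
  have tE : n.+2%:R = t ^+ 2 by rewrite sqr_sqrtr.
  have ts : t ^+ 2 = s ^+ 2 + 1 by rewrite -sE -tE -[in LHS]natr1.
  have st : s <= t by rewrite ler_sqrt// ler_nat.
  rewrite tE -lerBrDl.
  have -> : 3 - 2 / t - (3 - 2 / s) = 2 * (t - s) / (s * t).
    by field; rewrite !gt_eqF.
  have tsE : t - s = (t + s)^-1.
    have : (t - s) * (t + s) = 1 by rewrite -subr_sqr ts; ring.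
    by move=> h; apply: (mulIf (x := t + s)); rewrite ?h ?mulVf// gt_eqF// addr_gt0.
  have -> : t ^- 2 / t = 1 / (t ^+ 2 * t) by field; rewrite gt_eqF.
  rewrite tsE ler_pdivrMr; last by rewrite mulr_gt0// exprn_gt0.
  have -> : 2 * (t + s)^-1 / (s * t) * (t ^+ 2 * t) = 2 * t ^+ 2 / ((t + s) * s).
    by field; rewrite !gt_eqF ?addr_gt0.
  rewrite ler_pdivlMr ?mulr_gt0 ?addr_gt0// mul1r; nra.
case: M => [|M]; first by rewrite big_geq.
by apply: (le_trans (H M)); rewrite gerBl divr_ge0// sqrtr_ge0.
Qed.

Definition int_box (M : nat) : seq int :=
  [seq Posz n | n <- iota 0 M] ++ [seq Negz n | n <- iota 0 M].

Lemma int_box_uniq M : uniq (int_box M).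
Proof.
rewrite cat_uniq !map_inj_uniq ?iota_uniq//; last 2 first.
- by move=> x y [].
- by move=> x y [].
rewrite /= andbT; apply/hasPn => x /mapP[n _ ->]; apply/negP => /mapP[m _ //].
Qed.

Lemma mem_int_box (M : nat) (i : int) : (absz i < M)%N -> i \in int_box M.
Proof.
rewrite mem_cat; case: i => n nM; apply/orP; [left|right]; apply: map_f; rewrite mem_iota add0n /=.
  by [].
exact: ltnW nM.
Qed.

Lemma sum_int_box M : \sum_(i <- int_box M) pow_m32 (absz i) <= 6.
Proof.
rewrite big_cat !big_map /= -[M in iota 0 M]subn0 -/(index_iota 0 M).
have -> : (6 : R) = 3 + 3 by ring.
apply: lerD; first exact: sum_pow_m32.
apply: le_trans (sum_pow_m32 M.+1).
by rewrite [leRHS]big_nat_recl// lerDr pow_m32_ge0.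
Qed.

(** A finite set of pairs lies in a square box, over which the sum factors. *)
Lemma sum_lattice32 (s : seq (int * int)) : uniq s ->
  \sum_(p <- s) pow_m32 (absz p.1) * pow_m32 (absz p.2) <= 36.
Proof.
move=> us; pose M := (\max_(p <- s) maxn (absz p.1) (absz p.2)).+1.
apply: (@le_trans _ _ (\sum_(p <- [seq (i, j) | i <- int_box M, j <- int_box M]) pow_m32 (absz p.1) * pow_m32 (absz p.2))).
  apply: ler_sum_subseq => //.
  - by apply: allpairs_uniq; rewrite ?int_box_uniq// => -[? ?] [? ?] _ _ [-> ->].
  - move=> [i j] ps; have : (maxn (absz i) (absz j) < M)%N.
      by rewrite ltnS (big_rem (i, j) ps) /= leq_maxl.
    by rewrite gtn_max => /andP[iM jM]; apply/allpairsP; exists (i, j); rewrite !mem_int_box.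
  - by move=> p; rewrite mulr_ge0 ?pow_m32_ge0.
rewrite big_allpairs /=.
under eq_bigr do rewrite -mulr_sumr.
rewrite -mulr_suml.
have -> : (36 : R) = 6 * 6 by ring.
by apply: ler_pM; rewrite ?sum_int_box// sumr_ge0// => i _; exact: pow_m32_ge0.
Qed.
End Summable.

Section IdealSum.
Variables (R : realType) (K : fieldExtType rat).
Variable iota : {rmorphism K -> complex R}.
Local Notation re a := (complex.Re (iota a)).
Local Notation im a := (complex.Im (iota a)).
Local Notation O := (@ring_of_integers K).
Local Notation PI := principal_ideal.
Local Notation qnorm := (qnorm iota).
Local Notation Nm := (Nm R).
Local Notation int_disc := (int_disc iota).
Hypothesis hIQ : imaginary_quadratic iota.
Hypothesis hP : principal_ring_of_integers K.
Variable w : K.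
Hypotheses (Ow : O w) (w0 : 0 < im w).
Hypothesis Obas : forall a, O a -> exists i j : int, a = i%:~R + j%:~R * w.
Local Notation h := (im w).

(** Both |i| and |j| are O(|a|), and |a| >= 1 absorbs the two added units. *)
Lemma lattice_norm : exists2 D : R, 0 < D & forall (i j : int) a,
  a = i%:~R + j%:~R * w -> 1 <= qnorm a ->
  (absz i).+1%:R * (absz j).+1%:R <= D * qnorm a.
Proof.
have h0 := w0; have hi : 0 < h^-1 by rewrite invr_gt0.
pose c : R := `|re w|; have c0 : 0 <= c by exact: normr_ge0.
exists ((2 + c / h) * (1 + h^-1)).
  by apply: mulr_gt0; have := divr_ge0 c0 (ltW h0); lra.
move=> i j a aE a1; set N := Num.sqrt (qnorm a).
have N1 : 1 <= N by rewrite -[leLHS]sqrtr1 ler_sqrt// (le_trans ler01).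
have N0 : 0 < N by lra.
have N2 : qnorm a = N ^+ 2 by rewrite sqr_sqrtr// qnorm_ge0.
have reE : re a = i%:~R + j%:~R * re w by rewrite aE reD reM !re_int im_int; ring.
have imE : im a = j%:~R * h by rewrite aE imD imM !im_int re_int; ring.
have B x y : x ^+ 2 + y ^+ 2 = qnorm a -> `|x| <= N.
  move=> xy; rewrite -ler_sqr ?nnegrE ?(ltW N0)// real_normK ?num_real// -N2 -xy.
  by rewrite lerDl sqr_ge0.
have Bre : `|re a| <= N by exact: (B _ (im a)).
have Bim : `|im a| <= N by apply: (B _ (re a)); rewrite addrC.
have Bj : `|j%:~R| <= N / h :> R.
  by rewrite ler_pdivlMr// -{1}(gtr0_norm h0) -normrM -imE.
have Bi : `|i%:~R| <= N + N / h * c :> R.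
  have -> : i%:~R = re a - j%:~R * re w by rewrite reE; ring.
  by apply: le_trans (ler_normB _ _) _; rewrite lerD// normrM ler_wpM2r.
have ai (k : int) : (absz k).+1%:R = `|k%:~R| + 1 :> R.
  by rewrite -natr1 natr_absz intr_norm.
rewrite N2 expr2 mulrACA !ai; apply: ler_pM; rewrite ?addr_ge0//.
  have -> : (2 + c / h) * N = N + N + N / h * c by ring.
  lra.
have -> : (1 + h^-1) * N = N + N / h by ring.
lra.
Qed.

(** Choosing a generator i + j w of each ideal turns the sum into one over pairs
    of integers, where [lattice_norm] bounds N(I)^(-3/2) by a product of a
    function of i and a function of j. *)
Lemma ideal_sum_bound : exists2 B : R, 0 < B & forall L : seq (set K),
  uniq L -> (forall I, I \in L -> nonzero_ideal I) ->
  \sum_(I <- L) (Nm I)^-1 / Num.sqrt (Nm I) <= B.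
Proof.
have [D D0 HD] := lattice_norm.
exists (36 * (D * Num.sqrt D)); first by rewrite !mulr_gt0// sqrtr_gt0.
move=> L uL Lnz.
have [c cP] : exists c : set K -> int * int, forall I, I \in L ->
   exists a, [/\ O a, a != 0, I = PI a & a = (c I).1%:~R + (c I).2%:~R * w].
  have H I : exists p : int * int, I \in L ->
     exists a, [/\ O a, a != 0, I = PI a & a = p.1%:~R + p.2%:~R * w].
    have [/Lnz nI|] := boolP (I \in L); last by exists (0, 0).
    have [a [Oa a0 IE]] := nonzero_gen hP nI; have [i [j ij]] := Obas Oa.
    by exists (i, j) => _; exists a.
  by exists (fun I => sval (cid (H I))) => I; exact: svalP (cid (H I)).
have cI : {in L &, injective c}.
  by move=> I J /cP[a [_ _ -> aE]] /cP[b [_ _ -> bE]] IJ; rewrite aE bE IJ.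
apply: (@le_trans _ _ (\sum_(I <- L) (D * Num.sqrt D) * (pow_m32 R (absz (c I).1) * pow_m32 R (absz (c I).2)))).
  rewrite big_seq [leRHS]big_seq; apply: ler_sum => I IL.
  have [a [Oa a0 IE aE]] := cP I IL.
  have NE : Nm I = qnorm a by rewrite /Nm IE (ideal_norm_PI hIQ).
  have a1 := OK_qnorm_ge1 hIQ Oa a0.
  have := HD _ _ _ aE a1; rewrite -NE in a1 *.
  rewrite /pow_m32; set m := _.+1%:R; set n := _.+1%:R => mn.
  have m0 : 0 < m :> R by []. have n0 : 0 < n :> R by [].
  have N0 : 0 < Nm I by lra.
  have -> : D * Num.sqrt D * (m^-1 / Num.sqrt m * (n^-1 / Num.sqrt n)) =
    ((m * n) / D)^-1 / Num.sqrt ((m * n) / D).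
    rewrite sqrtrM ?mulr_ge0// sqrtrM// sqrtrV ?ltW//.
    by field; rewrite !gt_eqF ?sqrtr_gt0.
  have q0 : 0 < m * n / D by rewrite divr_gt0 ?mulr_gt0.
  have qN : m * n / D <= Nm I by rewrite ler_pdivrMr// [Nm I * D]mulrC.
  apply: ler_pM; rewrite ?invr_ge0 ?sqrtr_ge0//.
    by rewrite lef_pV2.
  by rewrite lef_pV2 ?posrE ?sqrtr_gt0// ler_sqrt// ltW.
rewrite -mulr_sumr mulrC ler_pM2r ?mulr_gt0 ?sqrtr_gt0//.
rewrite -(big_map c xpredT (fun p => pow_m32 R (absz p.1) * pow_m32 R (absz p.2))).
by apply: sum_lattice32; rewrite map_inj_in_uniq.
Qed.

Lemma prod_le_exp (T : Type) (s : seq T) (F : T -> R) : (forall x, 0 <= F x) ->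
  \prod_(x <- s) (1 + F x) <= expR (\sum_(x <- s) F x).
Proof.
move=> F0; elim: s => [|x s IH]; first by rewrite !big_nil expR0.
rewrite !big_cons expRD; apply: ler_pM => //.
- by rewrite addr_ge0.
- by apply: prodr_ge0 => i _; rewrite addr_ge0.
- exact: expR_ge1Dx.
Qed.

(** * The Euler product of zeta_K(2) *)

Lemma Nm_ge1 (I : set K) : nonzero_ideal I -> 1 <= Nm I.
Proof.
move=> nI; have [a [Oa a0 ->]] := nonzero_gen hP nI.
by rewrite /Nm (ideal_norm_PI hIQ)// (OK_qnorm_ge1 hIQ).
Qed.

Lemma Nm_sub (I J : set K) : nonzero_ideal I -> nonzero_ideal J -> I `<=` J -> Nm J <= Nm I.
Proof.
move=> nI nJ; have [a [Oa a0 ->]] := nonzero_gen hP nI.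
have [b [Ob b0 ->]] := nonzero_gen hP nJ => /(_ a (PI_id a))[c Oc cE].
have c0 : c != 0 by apply: contraNneq a0 => c0; rewrite -cE c0 mulr0.
rewrite /Nm !(ideal_norm_PI hIQ)// -cE qnormM ler_peMr ?qnorm_ge0// (OK_qnorm_ge1 hIQ) //.
Qed.

Definition ideals_coprime_to (S : seq (set K)) : set (set K) :=
  [set I | nonzero_ideal I /\ forall P, P \in S -> ~ (I `<=` P)].

Definition inv_norm2 (I : set K) : R := Nm I `^ (- 2).

Lemma inv_norm2E I : inv_norm2 I = (Nm I)^-1 ^+ 2.
Proof. by rewrite /inv_norm2 (powR_invn 2)// exprVn. Qed.
Lemma inv_norm2_ge0 I : 0 <= inv_norm2 I. Proof. exact: powR_ge0. Qed.

Definition zeta2_coprime_to S : R := fine (\esum_(I in ideals_coprime_to S) (inv_norm2 I)%:E).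

Lemma zeta2_coprime_to_nil : dedekind_zeta K 2 = zeta2_coprime_to [::].
Proof.
rewrite /dedekind_zeta /zeta2_coprime_to; congr (fine (esum _ _)).
by apply/seteqP; split => [I nI|I []].
Qed.

Section BoundedSums.
Variable B : R.
Hypothesis B0 : 0 < B.
Hypothesis HB : forall L : seq (set K),
  uniq L -> (forall I, I \in L -> nonzero_ideal I) ->
  \sum_(I <- L) (Nm I)^-1 / Num.sqrt (Nm I) <= B.

Lemma sieve_err_le (S : seq (set K)) : uniq S -> (forall P, P \in S -> nonzero_prime_ideal P) ->
  sieve_err R S <= expR B.
Proof.
move=> uS prS; rewrite /sieve_err; apply: le_trans (prod_le_exp _ _) _.
  by move=> P; rewrite divr_ge0 ?sqrtr_ge0// invr_ge0.
by rewrite ler_expR; apply: HB => // I /prS[].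
Qed.

Let inv_norm2_le (Y : R) I : 0 < Y -> nonzero_ideal I -> Y <= Nm I ->
  inv_norm2 I <= (Nm I)^-1 / Num.sqrt (Nm I) / Num.sqrt Y.
Proof.
move=> Y0 nI YI; have N0 : 0 < Nm I by exact: lt_le_trans YI.
rewrite inv_norm2E expr2 -mulrA ler_wpM2l ?invr_ge0//.
have E : (Nm I)^-1 = (Num.sqrt (Nm I))^-1 * (Num.sqrt (Nm I))^-1.
  by rewrite -invfM -expr2 sqr_sqrtr// ltW.
rewrite {1}E ler_wpM2l ?invr_ge0 ?sqrtr_ge0//.
by rewrite lef_pV2 ?posrE ?sqrtr_gt0// ler_sqrt// ltW.
Qed.

Let inv_norm2_tail (Y : R) (L : seq (set K)) : 0 < Y -> uniq L ->
  (forall I, I \in L -> nonzero_ideal I /\ Y <= Nm I) ->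
  \sum_(I <- L) inv_norm2 I <= B / Num.sqrt Y.
Proof.
move=> Y0 uL HL; apply: (@le_trans _ _ (\sum_(I <- L) (Nm I)^-1 / Num.sqrt (Nm I) / Num.sqrt Y)).
  by rewrite big_seq [leRHS]big_seq; apply: ler_sum => I /HL[nI YI]; exact: inv_norm2_le.
rewrite -mulr_suml ler_wpM2r ?invr_ge0 ?sqrtr_ge0//.
by apply: HB => // I /HL[].
Qed.

Lemma zeta2_coprime_to_fin S : \esum_(I in ideals_coprime_to S) (inv_norm2 I)%:E = (zeta2_coprime_to S)%:E.
Proof.
apply: (@esum_fin _ _ _ _ (B / Num.sqrt 1)) inv_norm2_ge0 _ => s us sS.
by apply: inv_norm2_tail => // I /sS[nI _]; split => //; exact: Nm_ge1.
Qed.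

Let O_ideal : nonzero_ideal O.
Proof.
have -> : O = PI 1.
  by apply/seteqP; split => [x Ox|_ [x Ox <-]]; [exists x|]; rewrite ?mul1r.
by apply: PI_nonzero; rewrite ?oner_eq0//; exact: OK1.
Qed.

Let inv_norm2_O : inv_norm2 O = 1.
Proof. by rewrite inv_norm2E /Nm (ideal_norm_O hIQ) invr1 expr1n. Qed.

Lemma zeta2_coprime_to_ge1 S : (forall P, P \in S -> nonzero_prime_ideal P) -> 1 <= zeta2_coprime_to S.
Proof.
move=> prS; rewrite -lee_fin -zeta2_coprime_to_fin.
have := @esum_ge_list R _ (ideals_coprime_to S) inv_norm2 [:: O] isT; rewrite big_seq1 inv_norm2_O; apply.
move=> I; rewrite inE => /eqP ->; split=> // P PS OP.
have pP := prS _ PS; have hPi := prime_is_ideal pP; case: (pP) => _ + _; apply.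
by apply: (ideal_1 hPi); apply: OP; exact: OK1.
Qed.

(** An ideal other than O is contained in a prime, which is not in S and hence of
    norm above Y.  So N(I) >= Y, and N(I)^(-2) <= N(I)^(-3/2) / sqrt Y. *)
Lemma zeta2_coprime_to_le (Y : R) S : 0 < Y -> (forall P, P \in S -> nonzero_prime_ideal P) ->
  (forall P, nonzero_prime_ideal P -> Nm P <= Y -> P \in S) ->
  zeta2_coprime_to S <= 1 + B / Num.sqrt Y.
Proof.
move=> Y0 prS SY; rewrite -lee_fin -zeta2_coprime_to_fin; apply: esum_le_list => s us sS.
rewrite (bigID (pred1 O)) /=; apply: lerD.
  rewrite -big_filter; have := filter_uniq (pred1 O) us.
  have : forall I, I \in [seq I <- s | pred1 O I] -> I = O.
    by move=> I; rewrite mem_filter => /andP[/eqP].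
  case: [seq _ <- _ | _] => [|I [|J l]] HO ul.
  - by rewrite big_nil.
  - by rewrite big_seq1 (HO I) ?mem_head// inv_norm2_O.
  - move: ul; rewrite (HO I) ?mem_head// (HO J) ?in_cons ?eqxx ?orbT//=.
    by rewrite in_cons eqxx.
rewrite -big_filter; apply: inv_norm2_tail => //; first exact: filter_uniq.
move=> I; rewrite mem_filter => /andP[/eqP IO /sS[nI IS]]; split => //.
have [P pP IP] := exists_prime_sup hIQ hP nI IO.
apply: le_trans (Nm_sub nI _ IP); last by case: pP.
by rewrite leNgt; apply/negP => PY; apply: (IS P) IP; apply: SY => //; exact: ltW.
Qed.

(** The ideals prime to S are those prime to [P :: S] and the products PJ with J
    prime to S; the latter contribute N(P)^(-2) times the whole sum. *)
Lemma zeta2_coprime_to_cons P S : P \notin S -> nonzero_prime_ideal P ->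
  (forall Q, Q \in S -> nonzero_prime_ideal Q) ->
  zeta2_coprime_to (P :: S) = (1 - (Nm P)^-1 ^+ 2) * zeta2_coprime_to S.
Proof.
move=> PS pP prS; have [p [Op p0 PE Np p2]] := prime_gen hIQ hP pP.
have hPi := prime_is_ideal pP.
pose B' : set (set K) := [set I | ~ (I `<=` P)].
pose m (J : set K) : set K := [set p * y | y in J].
have Qp Q : Q \in S -> ~ Q p.
  move=> QS; apply: (prime_neq hP pP (prS _ QS)) => // QP.
  by rewrite -QP QS in PS.
have mPI a : m (PI a) = PI (p * a).
  apply/seteqP; split => [_ [_ [b Ob <-] <-]|_ [b Ob <-]].
    by exists b; rewrite ?mulrA.
  by exists (a * b); [exists b|rewrite mulrA].
have H := esumID B' (ideals_coprime_to S) (fun I => (inv_norm2 I)%:E) (fun I _ => inv_norm2_ge0 I).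
have E1 : ideals_coprime_to S `&` B' = ideals_coprime_to (P :: S).
  apply/seteqP; split => [I [[nI IS] IP]|I [nI IS]].
    by split => // Q; rewrite in_cons => /predU1P[->|/IS].
  split; first by split=> // Q QS; apply: IS; rewrite in_cons QS orbT.
  by apply: IS; rewrite mem_head.
have E2 : ideals_coprime_to S `&` ~` B' = m @` ideals_coprime_to S.
  apply/seteqP; split => [I [[nI IS] /contrapT IP]|_ [J [nJ JS] <-]].
    have [a [Oa a0 IE]] := nonzero_gen hP nI.
    have [c Oc cE] : PI p a by rewrite -PE; apply: IP; rewrite IE; exact: PI_id.
    have c0 : c != 0 by apply: contraNneq a0 => c0; rewrite -cE c0 mulr0.
    have mI : m (PI c) = I by rewrite mPI cE IE.
    exists (PI c) => //; split; first exact: PI_nonzero.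
    move=> Q QS cQ; apply: (IS _ QS); rewrite -mI => _ [y cy <-].
    by apply: idealMl => //; [exact: prime_is_ideal (prS _ QS)|exact: cQ].
  have [a [Oa a0 JE]] := nonzero_gen hP nJ.
  have mP : m J `<=` P.
    move=> _ [y Jy <-]; apply: idealMr => //; last by rewrite PE; exact: PI_id.
    by case: nJ => hJ _; exact: ideal_sub hJ Jy.
  split; last by move=> /(_ mP).
  split.
    by rewrite JE mPI; apply: PI_nonzero; [exact: OKM|rewrite mulf_neq0].
  move=> Q QS mQ; apply: (JS _ QS) => y Jy.
  have Oy : O y by case: nJ => hJ _; exact: ideal_sub hJ Jy.
  have : Q (p * y) by apply: mQ; exists y.
  by move=> /(primeM (prS _ QS) Op Oy)[/(Qp _ QS)|].
have mI : set_inj (ideals_coprime_to S) m.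
  move=> I J _ _ mIJ; apply/seteqP; split => y Hy.
    have : m I (p * y) by exists y.
    by rewrite mIJ => -[y' ? /(mulfI p0) <-].
  have : m J (p * y) by exists y.
  by rewrite -mIJ => -[y' ? /(mulfI p0) <-].
have c0 : 0 < (Nm P)^-1 ^+ 2 by rewrite exprn_gt0// invr_gt0 /Nm -Np; lra.
move: H; rewrite E1 E2 esum_image// !zeta2_coprime_to_fin.
have -> : \esum_(i in ideals_coprime_to S) (inv_norm2 (m i))%:E = \esum_(i in ideals_coprime_to S) ((Nm P)^-1 ^+ 2 * inv_norm2 i)%:E.
  apply: eq_esum => I [nI _]; have [a [Oa a0 IE]] := nonzero_gen hP nI.
  rewrite !inv_norm2E IE mPI /Nm !(ideal_norm_PI hIQ)//; last 2 first.
  - exact: OKM.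
  - by rewrite mulf_neq0.
  by rewrite qnormM Np invfM exprMn.
rewrite (esumZ_fin c0 inv_norm2_ge0 (zeta2_coprime_to_fin S)) -EFinD => -[H].
by rewrite mulrBl mul1r {1}H addrK.
Qed.

Lemma zeta2_coprime_to_prod S : uniq S -> (forall P, P \in S -> nonzero_prime_ideal P) ->
  zeta2_coprime_to S = zeta2_coprime_to [::] * \prod_(P <- S) (1 - (Nm P)^-1 ^+ 2).
Proof.
elim: S => [|P S IH] /=; first by rewrite big_nil mulr1.
move=> /andP[PS uS] prS.
have prS' Q : Q \in S -> nonzero_prime_ideal Q by move=> QS; apply: prS; rewrite in_cons QS orbT.
have pP := prS P (mem_head _ _).
by rewrite (zeta2_coprime_to_cons PS pP prS') (IH uS prS') big_cons mulrCA.
Qed.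

End BoundedSums.

Lemma primes_list (Y : R) : exists S : seq (set K), [/\ uniq S,
  (forall P, P \in S -> nonzero_prime_ideal P) &
  (forall P, nonzero_prime_ideal P -> Nm P <= Y -> P \in S)].
Proof.
have fin : finite_set [set P : set K | nonzero_prime_ideal P /\ Nm P <= Y].
  apply: (@sub_finite_set _ _ [set PI a | a in int_disc Y]); last by apply: finite_image; exact: (int_disc_finite w0 Obas).
  move=> P [pP PY]; have [p [Op p0 PE Np _]] := prime_gen hIQ hP pP.
  by exists p => //; split => //; rewrite Np.
have [S [uS SE _]] := finite_list fin.
by exists S; split=> // [P /SE[]|P pP PY] //; apply/SE.
Qed.

End IdealSum.

(** * The asymptotic formula *)

Section Assemble.
Variables (R : realType) (K : fieldExtType rat).
Variable iota : {rmorphism K -> complex R}.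
Local Notation im a := (complex.Im (iota a)).
Local Notation O := (@ring_of_integers K).
Local Notation PI := principal_ideal.
Local Notation qnorm := (qnorm iota).
Local Notation Nm := (Nm R).
Hypothesis hIQ : imaginary_quadratic iota.
Hypothesis hP : principal_ring_of_integers K.

Lemma prime_divides_principal (P : set K) b : nonzero_prime_ideal P -> O b ->
  ideal_divides P (PI b) <-> P b.
Proof.
move=> pP Ob; have hPi := prime_is_ideal pP; split.
  move=> [I hI bE]; have : PI b b := PI_id b.
  rewrite bE => /(_ P); apply; split => //.
  by move=> _ [x Px [y Iy <-]]; apply: idealMr => //; exact: ideal_sub hI Iy.
have [p [Op p0 PE _ _]] := prime_gen hIQ hP pP.
rewrite {1}PE => -[c Oc cE]; exists (PI c); first exact: principal_is_ideal.
apply/seteqP; split.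
  move=> _ [d Od <-] M [hM GM]; apply: GM; exists p; first by rewrite PE; exact: PI_id.
  by exists (c * d); [exists d|rewrite mulrA cE].
move=> x; apply; split; first exact: principal_is_ideal.
rewrite PE => _ [_ [u Ou <-] [_ [v Ov <-] <-]].
by exists (u * v); [exact: OKM|rewrite -cE mulrACA].
Qed.

Lemma c_ideal_principal S b : uniq S -> (forall P, P \in S -> nonzero_prime_ideal P) ->
  O b -> b != 0 -> (forall P, nonzero_prime_ideal P -> P b -> P \in S) ->
  c_ideal R (PI b) = qnorm b * \prod_(P <- S | `[< P b >]) (1 + (Nm P)^-1).
Proof.
move=> uS prS Ob b0 bS; rewrite /c_ideal (ideal_norm_PI hIQ)//; congr (_ * _).
rewrite -[RHS]big_filter; apply: fsbig_list; first exact: filter_uniq.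
move=> P; rewrite mem_filter; split.
  move=> [pP /(prime_divides_principal pP Ob) Pb].
  by rewrite bS// andbT; apply/asboolP.
by move=> /andP[/asboolP Pb /prS pP]; split => //; exact/prime_divides_principal.
Qed.

Lemma Nm_le_qnorm (P : set K) a : nonzero_prime_ideal P -> O a -> a != 0 -> P a -> Nm P <= qnorm a.
Proof.
move=> pP Oa a0 Pa; rewrite -(ideal_norm_PI hIQ Oa a0).
apply: (Nm_sub hIQ hP (PI_nonzero Oa a0)); first by case: pP.
exact: PI_sub (prime_is_ideal pP) Pa.
Qed.

(** At the primes that contain b, (1 - 1/N)(1 + 1/N) = 1 - 1/N^2. *)
Lemma sieved_density_c_ideal S b : uniq S -> (forall P, P \in S -> nonzero_prime_ideal P) ->
  O b -> b != 0 -> (forall P, nonzero_prime_ideal P -> P b -> P \in S) ->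
  sieved_density iota S b * c_ideal R (PI b) = \prod_(P <- S) (1 - (Nm P)^-1 ^+ 2).
Proof.
move=> uS prS Ob b0 bS; rewrite (c_ideal_principal uS prS Ob b0 bS) /sieved_density.
rewrite mulrACA mulVf ?mul1r; last by rewrite gt_eqF// qnorm_gt0.
rewrite [in X in _ * X]big_mkcond -big_split /=; apply: eq_bigr => P _.
by case: ifP => _; [rewrite -subr_sqr expr1n | rewrite mulr1].
Qed.

Lemma c_ideal_gt0 b : O b -> b != 0 -> 0 < c_ideal R (PI b).
Proof.
move=> Ob b0; have [w [Ow w0] Obas] := exists_omega hIQ.
have [S [uS prS SY]] := primes_list hIQ hP w0 Obas (qnorm b).
rewrite (c_ideal_principal uS prS Ob b0) ?mulr_gt0 ?qnorm_gt0//.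
  by apply: prodr_gt0 => P _; rewrite ltr_wpDr// invr_ge0.
by move=> P pP Pb; apply: SY => //; exact: Nm_le_qnorm.
Qed.

End Assemble.

Theorem theorem1p2 (R : realType) (K : fieldExtType rat)
  (iota : {rmorphism K -> complex R})
  (K_imaginary_quadratic : imaginary_quadratic iota)
  (OK_principal : principal_ring_of_integers K) :
  exists C x0 : R, [/\ 0 < C, 1 <= x0 &
    forall (m : set K) (z : complex R) (theta x : R),
      nonzero_ideal m -> z != 0 -> 0 < theta <= 2 * pi -> x0 <= x ->
      `| \sum_(a \in m `&` iota @^-1` angular_sector z theta x)
            ((elt_phi a)%:R : R)
         - theta / (2 * Num.sqrt `|ratr (field_disc K)|
                      * dedekind_zeta K 2 * c_ideal R m) * x ^+ 4 |
      <= C * x ^+ 3].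
Proof.
have hIQ := K_imaginary_quadratic; have hP := OK_principal.
have [w [Ow w0] Obas] := exists_omega hIQ.
have [C0 C00 HC] := sector_sum hIQ Ow w0 Obas.
have [B B0 HB] := ideal_sum_bound hIQ hP w0 Obas.
have E0 : 0 < C0 * expR B by rewrite mulr_gt0// expR_gt0.
(* The factor expR B bounds the error of the sieve; the added 1 pays for the
   ideals prime to S. *)
exists (C0 * expR B + 1), 1; split=> //; first by rewrite addr_gt0.
move=> m z th x nm z0 th0 x1.
have [b [Ob b0 ->]] := nonzero_gen hP nm.
have x0 : 0 < x by exact: lt_le_trans ltr01 x1.
have th1 : 0 < th by case/andP: th0.
rewrite (sqrt_disc hIQ Ow w0 Obas) (zeta2_coprime_to_nil R K).
set h := complex.Im (iota w); set zeta := zeta2_coprime_to R [::]; set c := c_ideal R _.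
have z1 : 1 <= zeta by apply: (zeta2_coprime_to_ge1 hIQ hP HB).
have zp : 0 < zeta by exact: lt_le_trans ltr01 z1.
have cp : 0 < c by exact: (c_ideal_gt0 hIQ hP).
set X := iota @^-1` angular_sector z th x.
have XP a : ring_of_integers a -> X a -> a != 0 /\ qnorm iota a <= x ^+ 2.
  have [tau _ zE] := sector_polar z0.
  move=> Oa Xa; have : (@ring_of_integers K `&` X) a by [].
  by rewrite /X (iota_sector iota th (ltW x0) z0 zE) => -[].
have [l [ul lE _]] := finite_list (PI_sector_finite HC z0 th0 x0 Ob).
have lO a : a \in l -> [/\ ring_of_integers a, a != 0 & qnorm iota a <= x ^+ 2].
  move=> /lE[[y Oy <-] Xa]; have Oa : ring_of_integers (b * y) by exact: OKM.
  by have [] := XP _ Oa Xa.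
(* M is the main term of the statement. *)
pose M := th / (4 * h) * x ^+ 4 / (zeta * c).
have M0 : 0 <= M.
  apply: ltW; apply: divr_gt0; last exact: mulr_gt0.
  by apply: mulr_gt0; [apply: divr_gt0 => //; exact: mulr_gt0|exact: exprn_gt0].
have -> : th / (2 * (2 * h) * zeta * c) * x ^+ 4 = M.
  by rewrite /M; field; rewrite !gt_eqF.
(* The first two terms make S contain all primes that divide b or a point of the
   sector; the third makes M B / sqrt Y, which bounds the contribution of the
   ideals prime to S, at most 1. *)
pose Y := x ^+ 2 + qnorm iota b + (M * B) ^+ 2 + 1.
have x20 := sqr_ge0 x; have nb0 := qnorm_ge0 iota b; have MB0 := sqr_ge0 (M * B).
have Y0 : 0 < Y by rewrite /Y; lra.
have [S [uS prS SY]] := primes_list hIQ hP w0 Obas Y.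
have inS P a : nonzero_prime_ideal P -> ring_of_integers a -> a != 0 -> qnorm iota a <= Y -> P a -> P \in S.
  move=> pP Oa a0 aY Pa; apply: SY => //.
  by apply: le_trans (Nm_le_qnorm hIQ hP pP Oa a0 Pa) aY.
have -> : \sum_(a \in principal_ideal b `&` X) ((elt_phi a)%:R : R) = \sum_(a \in principal_ideal b `&` X) sieved_phi iota S a.
  rewrite !(fsbig_list _ _ ul lE); apply: eq_big_seq => a /lO[Oa a0 ax].
  apply: (elt_phiE hIQ hP) => // P pP Pa; apply: (inS P a) => //.
  by apply: (le_trans ax); rewrite /Y; lra.
have := sieve hIQ hP w0 C00 HC z0 th0 x0 uS prS Ob b0.
have bS P : nonzero_prime_ideal P -> P b -> P \in S.
  by move=> pP Pb; apply: (inS P b) => //; rewrite /Y; lra.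
have mE : sieved_density iota S b = zeta2_coprime_to R S / (zeta * c).
  rewrite (zeta2_coprime_to_prod hIQ hP HB uS prS) -(sieved_density_c_ideal hIQ hP uS prS Ob b0 bS).
  by rewrite -/zeta -/c; field; rewrite !gt_eqF.
have -> : th / (4 * h) * x ^+ 4 * sieved_density iota S b = M * zeta2_coprime_to R S.
  by rewrite mE /M; ring.
set T := \sum_(a \in _) _ => H.
have zS1 : 1 <= zeta2_coprime_to R S by apply: (zeta2_coprime_to_ge1 hIQ hP HB).
have zS2 := zeta2_coprime_to_le hIQ hP HB Y0 prS SY.
have sY : 0 < Num.sqrt Y by rewrite sqrtr_gt0.
have x3 : 1 <= x ^+ 3 by rewrite expr_ge1// ltW.
have tail : M * (zeta2_coprime_to R S - 1) <= x ^+ 3.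
  apply: le_trans x3; apply: (@le_trans _ _ (M * (B / Num.sqrt Y))).
    by rewrite ler_wpM2l//; lra.
  rewrite mulrA ler_pdivrMr// mul1r.
  rewrite -[leLHS]ger0_norm ?(mulr_ge0 M0 (ltW B0))// -sqrtr_sqr ler_sqrt//; rewrite /Y; lra.
have main : C0 * x ^+ 3 * sieve_err R S / Num.sqrt (qnorm iota b) <= C0 * expR B * x ^+ 3.
  rewrite ler_pdivrMr ?sqrtr_gt0 ?qnorm_gt0//.
  have s1 : 1 <= Num.sqrt (qnorm iota b).
    by rewrite -[leLHS]sqrtr1 ler_sqrt ?(OK_qnorm_ge1 hIQ)// qnorm_ge0.
  have e1 := sieve_err_le HB uS prS.
  have p0 : 0 <= C0 * expR B * x ^+ 3.
    by apply: mulr_ge0; [exact: ltW|rewrite exprn_ge0// ltW].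
  apply: le_trans (ler_peMr p0 s1).
  rewrite [leRHS]mulrAC ler_wpM2l// mulr_ge0 ?exprn_ge0//; exact: ltW.
have Mz : 0 <= M * (zeta2_coprime_to R S - 1) by rewrite mulr_ge0// subr_ge0.
have {}H := le_trans H main.
move: H tail Mz; rewrite !ler_norml => /andP[? ?] ? ?.
by apply/andP; split; lra.
Qed.
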